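(* For $n\in\mathbb{N}_0$, $$\frac{d^n}{dz^n}\big\{\Phi_{\gamma,\vartheta;\upsilon}(z,\sigma,a;p,\lambda)\big\}=\frac{(\gamma)_n(\vartheta)_n}{(\upsilon)_n}\,\Phi_{\gamma+n,\vartheta+n;\upsilon+n}(z,\sigma,a+n;p,\lambda),$$ where $\Phi_{\gamma,\vartheta;\upsilon}(z,\sigma,a;p,\lambda)$ is the extended Hurwitz-Lerch Zeta function.
   Context: $\mathbb{N}_0=\{0,1,2,\dots\}$; $(\gamma)_n=\gamma(\gamma+1)\cdots(\gamma+n-1)$, $(\gamma)_0=1$, is the Pochhammer symbol; $B(x,y)$ is the classical beta function. The Mittag-Leffler function is $E_\lambda(w)=\sum_{n=0}^\infty \frac{w^n}{\Gamma(\lambda n+1)}$. For $\Re(x)>0$, $\Re(y)>0$ the extended beta function is $$B(x,y;p,\lambda)=\int_0^1 t^{x-1}(1-t)^{y-1}E_\lambda\Big(-\frac{p}{t(1-t)}\Big)dt.$$ The extended Hurwitz-Lerch Zeta function is $$\Phi_{\gamma,\vartheta;\upsilon}(z,\sigma,a;p,\lambda)=\sum_{k=0}^\infty\frac{(\gamma)_k\,B(\vartheta+k,\upsilon-\vartheta;p,\lambda)}{B(\vartheta,\upsilon-\vartheta)\,k!}\frac{z^k}{(k+a)^\sigma},$$ for $p\ge0$, $\lambda>0$, $\gamma,\vartheta,\upsilon\in\mathbb{C}$, $a\in\mathbb{C}\setminus\{0,-1,-2,\dots\}$, with $\sigma\in\mathbb{C}$ when $|z|<1$ and $\Re(\sigma+\upsilon-\gamma-\vartheta)>1$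 when $|z|=1$. *)

(* Defs.v *)
From Stdlib Require Export Reals Factorial.
From Coquelicot Require Export Coquelicot.

Open Scope R_scope.

Definition Cexp (z : C) : C := (exp (Re z) * cos (Im z), exp (Re z) * sin (Im z)).

(* Principal value, in (-PI, PI]; meaningful for z <> 0. *)
Definition Carg (z : C) : R :=
  if Rle_dec 0 (Im z) then acos (Re z / Cmod z) else - acos (Re z / Cmod z).

Definition Clog (z : C) : C := (ln (Cmod z), Carg z).

Definition Cpower (w s : C) : C := Cexp (s * Clog w)%C.

Fixpoint pochhammer (g : C) (n : nat) : C :=
  match n with
  | O => RtoC 1
  | S m => (pochhammer g m * (g + INR m))%C
  end.

(* Complex convergence is convergence of real and imaginary parts. *)
Definition CSeries (u : nat -> C) : C :=
  (Series (fun k => Re (u k)), Series (fun k => Im (u k))).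

Definition Gamma (s : R) : R :=
  RInt_gen (fun t => Rpower t (s - 1) * exp (- t))
    (at_right 0) (Rbar_locally p_infty).

Definition MittagLeffler (lambda w : R) : R :=
  Series (fun n => w ^ n / Gamma (lambda * INR n + 1)).

Definition beta_integrand (x y : C) (t : R) : C :=
  (Cpower t (x - 1) * Cpower (1 - t)%R (y - 1))%C.

Definition Beta (x y : C) : C :=
  RInt_gen (V := C_R_CompleteNormedModule) (beta_integrand x y)
    (at_right 0) (at_left 1).

Definition ext_beta_integrand (x y : C) (p lambda t : R) : C :=
  (beta_integrand x y t * MittagLeffler lambda (- (p / (t * (1 - t))))%R)%C.

Definition ext_Beta (x y : C) (p lambda : R) : C :=
  RInt_gen (V := C_R_CompleteNormedModule)
    (fun t => ext_beta_integrand x y p lambda t) (at_right 0) (at_left 1).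

Definition ext_Beta_converges (p lambda : R) : Prop :=
  forall x y : C, 0 < Re x -> 0 < Re y ->
    ex_RInt_gen (V := C_R_NormedModule)
      (fun t => ext_beta_integrand x y p lambda t) (at_right 0) (at_left 1).

Definition ext_HurwitzLerch (gamma theta upsilon z sigma a : C) (p lambda : R) : C :=
  CSeries (fun k : nat =>
    (pochhammer gamma k * ext_Beta (theta + INR k) (upsilon - theta) p lambda
       / (Beta theta (upsilon - theta) * INR (fact k))
     * (z ^ k / Cpower (INR k + a) sigma))%C).

(* Complex derivative of f at z along D; at interior points of D this is
   Coquelicot's [is_derive] over C. *)
Definition is_C_derive_in (D : C -> Prop) (f : C -> C) (z l : C) : Prop :=
  filterdiff (K := C_AbsRing) (U := AbsRing_NormedModule C_AbsRing)
    (V := C_NormedModule) f (within D (locally (T := C_UniformSpace) z)) (fun h : C => (h * l)%C).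

Fixpoint is_C_derive_n_in (D : C -> Prop) (f : C -> C) (n : nat) (g : C -> C) : Prop :=
  match n with
  | O => forall z, D z -> f z = g z
  | S m => exists f' : C -> C,
      (forall z, D z -> is_C_derive_in D f z (f' z)) /\ is_C_derive_n_in D f' m g
  end.

(* Main.v *)
Require Import Defs.
From Stdlib Require Import Reals.
From Coquelicot Require Import Coquelicot.
From Stdlib Require Import Lra Lia Psatz Classical FunctionalExtensionality PropExtensionality.

(* The k-th coefficient of the n-th derived power series is (n + k)! / k! times the
   coefficient of index n + k; the recurrence (x + y) B(x + 1, y) = x B(x, y) and
   (g)_(n + k) = (g)_n (g + n)_k turn it into the claimed coefficient. What remains is
   termwise differentiation, which needs growth bounds on the coefficients. Since the
   integrals defining the extended beta function need only converge conditionally, they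
   are bounded by Abel's method: the integrand at theta + k is the integrand at theta
   times a weight t^k (1 - t)^d, whose total variation is O(k^-d). With d = 0 this
   gives convergence in the open disc; with d slightly below Re (upsilon - theta) the
   n-times derived series converges absolutely on the closed disc. *)

Open Scope R_scope.

(** * Power series over C *)

(** Two obstacles shape the proof. A point of the unit circle has no larger disc of convergence
    around it, so second derivatives cannot bound the Taylor remainder of the whole series; termwise
    differentiation therefore uses only summability of the first derived series at the radius
    itself, and the derivative is taken relative to the disc. Further, the integrals are total
    functions with value 0 when they diverge, and the statement on the open disc carries no
    convergence assumption; the recurrence of [Beta] and the bound on [ext_Beta] are therefore
    proved for these default values as well.

    The exponent [d] stays strictly below Re (upsilon - theta) because the integral at (theta,
    upsilon - theta - d), to which all others are compared, must itself converge. The loss is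
    absorbed by the strict inequality assumed on the parameters. *)

Lemma Rabs_Re_le_Cmod (z : C) : Rabs (Re z) <= Cmod z.
Proof. exact (Rle_trans _ _ _ (Rmax_l _ _) (Rmax_Cmod z)). Qed.

Lemma Rabs_Im_le_Cmod (z : C) : Rabs (Im z) <= Cmod z.
Proof. exact (Rle_trans _ _ _ (Rmax_r _ _) (Rmax_Cmod z)). Qed.

Lemma Cmod_le_Re_Im (z : C) : Cmod z <= Rabs (Re z) + Rabs (Im z).
Proof.
  destruct z as [x y]; simpl.
  replace ((x, y) : C) with (RtoC x + RtoC y * Ci)%C
    by (unfold RtoC, Ci, Cplus, Cmult; simpl; f_equal; ring).
  eapply Rle_trans; [apply Cmod_triangle|].
  rewrite Cmod_mult, !Cmod_R, Cmod_Ci; lra.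
Qed.

Definition abs_summable (u : nat -> C) : Prop := ex_series (fun k => Cmod (u k)).

Lemma abs_summable_Re (u : nat -> C) :
  abs_summable u -> ex_series (fun k => Rabs (Re (u k))).
Proof.
  intros H; apply (ex_series_le (V := R_CompleteNormedModule) _ (fun k => Cmod (u k))); [|exact H].
  intros k; change (Rabs (Rabs (Re (u k))) <= Cmod (u k)).
  rewrite Rabs_Rabsolu; apply Rabs_Re_le_Cmod.
Qed.

Lemma abs_summable_Im (u : nat -> C) :
  abs_summable u -> ex_series (fun k => Rabs (Im (u k))).
Proof.
  intros H; apply (ex_series_le (V := R_CompleteNormedModule) _ (fun k => Cmod (u k))); [|exact H].
  intros k; change (Rabs (Rabs (Im (u k))) <= Cmod (u k)).
  rewrite Rabs_Rabsolu; apply Rabs_Im_le_Cmod.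
Qed.

Lemma Series_Rabs_le (a b : nat -> R) :
  ex_series b -> (forall k, Rabs (a k) <= b k) -> Rabs (Series a) <= Series b.
Proof.
  intros Hb Hab.
  assert (Ha : ex_series (fun k => Rabs (a k))).
  { apply (ex_series_le (V := R_CompleteNormedModule) _ b); [|exact Hb].
    intros k; change (Rabs (Rabs (a k)) <= b k); rewrite Rabs_Rabsolu; apply Hab. }
  eapply Rle_trans; [apply Series_Rabs, Ha|].
  apply Series_le; [|exact Hb].
  intros k; split; [apply Rabs_pos|apply Hab].
Qed.

Lemma abs_summable_le (u : nat -> C) (b : nat -> R) :
  ex_series b -> (forall k, Cmod (u k) <= b k) -> abs_summable u.
Proof.
  intros Hb H; apply (ex_series_le (V := R_CompleteNormedModule) _ b); [|exact Hb].
  intros k; change (Rabs (Cmod (u k)) <= b k).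
  rewrite Rabs_pos_eq by apply Cmod_ge_0; apply H.
Qed.

(** The factor 2 comes from bounding the real and imaginary parts separately. *)
Lemma Cmod_CSeries_le (u : nat -> C) (b : nat -> R) :
  ex_series b -> (forall k, Cmod (u k) <= b k) -> Cmod (CSeries u) <= 2 * Series b.
Proof.
  intros Hb H; eapply Rle_trans; [apply Cmod_le_Re_Im|]; simpl.
  assert (Rabs (Series (fun k => Re (u k))) <= Series b).
  { apply Series_Rabs_le; [exact Hb|].
    intros k; eapply Rle_trans; [apply Rabs_Re_le_Cmod|apply H]. }
  assert (Rabs (Series (fun k => Im (u k))) <= Series b).
  { apply Series_Rabs_le; [exact Hb|].
    intros k; eapply Rle_trans; [apply Rabs_Im_le_Cmod|apply H]. }
  unfold Re, Im in *; simpl in *; lra.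
Qed.

Lemma CSeries_ext (u v : nat -> C) : (forall k, u k = v k) -> CSeries u = CSeries v.
Proof. intros H; f_equal; apply functional_extensionality, H. Qed.

Lemma CSeries_minus (u v : nat -> C) : abs_summable u -> abs_summable v ->
  CSeries (fun k => (u k - v k)%C) = (CSeries u - CSeries v)%C.
Proof.
  intros Hu Hv; unfold CSeries, Cminus, Cplus, Copp, Re, Im; simpl.
  f_equal; apply (Series_minus); apply ex_series_Rabs;
  (apply abs_summable_Re || apply abs_summable_Im); assumption.
Qed.

(** Summability is asked of the product because the factor it serves, a quotient of Pochhammer
    symbols, may vanish: only the scaled series is then known to be summable, and both sides are
    0. *)
Lemma CSeries_scal (c : C) (u : nat -> C) : abs_summable (fun k => (c * u k)%C) ->
  CSeries (fun k => (c * u k)%C) = (c * CSeries u)%C.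
Proof.
  intros Hcu; destruct (Ceq_dec c 0) as [->|Hc].
  { unfold CSeries, Cmult, Re, Im; simpl.
    f_equal; rewrite !Rmult_0_l, ?Rminus_0_r, ?Rplus_0_r;
      (transitivity (0 * Series (fun k => Re (u k))); [|ring]);
      rewrite <- Series_scal_l; apply Series_ext; intros k; ring. }
  assert (Hu : abs_summable u).
  { apply (abs_summable_le _ _ (ex_series_scal (V := R_NormedModule) (/ Cmod c) _ Hcu)).
    intros k; rewrite Cmod_mult; right; symmetry.
    change (/ Cmod c * (Cmod c * Cmod (u k)) = Cmod (u k)).
    apply Cmod_gt_0 in Hc; field; lra. }
  unfold CSeries, Cmult, Re, Im; simpl.
  pose proof (ex_series_Rabs _ (abs_summable_Re _ Hu)) as H1.
  pose proof (ex_series_Rabs _ (abs_summable_Im _ Hu)) as H2.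
  unfold Re, Im in H1, H2.
  pose proof (fun c => ex_series_scal (V := R_NormedModule) c _ H1) as H1'.
  pose proof (fun c => ex_series_scal (V := R_NormedModule) c _ H2) as H2'.
  f_equal; [rewrite (Series_minus (fun k => fst c * fst (u k)))
           |rewrite (Series_plus (fun k => fst c * snd (u k)))];
   rewrite ?Series_scal_l; try reflexivity; auto.
Qed.

Lemma CSeries_incr_1 (u : nat -> C) : abs_summable u ->
  CSeries u = (u O + CSeries (fun k => u (S k)))%C.
Proof.
  intros Hu; unfold CSeries, Cplus, Re, Im; simpl.
  f_equal; apply Series_incr_1; apply ex_series_Rabs;
  [apply abs_summable_Re|apply abs_summable_Im]; assumption.
Qed.

(** * Taylor remainders of monomials and termwise differentiation *)

Definition Cpseries (c : nat -> C) (z : C) : C := CSeries (fun k => (c k * z ^ k)%C).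

Definition dcoef (c : nat -> C) (k : nat) : C := (INR (S k) * c (S k))%C.

(** The degree is [S k], so that the derivative of the monomial carries the index used by [dcoef];
    the constant term has no remainder. *)
Definition taylor_remainder (k : nat) (z w : C) : C :=
  (w ^ S k - z ^ S k - (w - z) * (INR (S k) * z ^ k))%C.

Lemma Cmod_pow_le (r : R) (z : C) (k : nat) : Cmod z <= r -> Cmod (z ^ k)%C <= r ^ k.
Proof.
  intros H; rewrite Cmod_pow; apply pow_incr; split; [apply Cmod_ge_0|exact H].
Qed.

Lemma Cmod_pow_minus_le (r : R) (z w : C) (k : nat) : Cmod z <= r -> Cmod w <= r ->
  Cmod (w ^ S k - z ^ S k)%C <= INR (S k) * r ^ k * Cmod (w - z)%C.
Proof.
  intros Hz Hw; assert (0 <= r) by (eapply Rle_trans; [apply Cmod_ge_0|exact Hz]).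
  induction k as [|k IH].
  - simpl; rewrite !Cmult_1_r; lra.
  - replace (w ^ S (S k) - z ^ S (S k))%C
      with (w * (w ^ S k - z ^ S k) + z ^ S k * (w - z))%C by (simpl; ring).
    eapply Rle_trans; [apply Cmod_triangle|]; rewrite !Cmod_mult.
    pose proof (Cmod_ge_0 (w - z)%C).
    assert (Cmod w * Cmod (w ^ S k - z ^ S k)%C
            <= r * (INR (S k) * r ^ k * Cmod (w - z)%C))
      by (apply Rmult_le_compat; auto using Cmod_ge_0).
    assert (Cmod (z ^ S k)%C * Cmod (w - z)%C <= r ^ S k * Cmod (w - z)%C)
      by (apply Rmult_le_compat_r; auto using Cmod_pow_le).
    rewrite (S_INR (S k)); simpl (r ^ S k) in *; lra.
Qed.

(** Only first order in [w - z], but with constants that are summable against [c (S k)] at radius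
    [r]; this serves the tail of the series. *)
Lemma taylor_remainder_linear (r : R) (z w : C) (k : nat) :
  Cmod z <= r -> Cmod w <= r ->
  Cmod (taylor_remainder k z w) <= 2 * (INR (S k) * r ^ k) * Cmod (w - z)%C.
Proof.
  intros Hz Hw; unfold taylor_remainder.
  eapply Rle_trans; [apply Cmod_triangle|].
  pose proof (Cmod_pow_minus_le r z w k Hz Hw).
  rewrite Cmod_opp, !Cmod_mult, Cmod_R, (Rabs_pos_eq _ (pos_INR _)).
  pose proof (Cmod_ge_0 (w - z)%C).
  assert (Cmod (w - z)%C * (INR (S k) * Cmod (z ^ k)%C)
          <= Cmod (w - z)%C * (INR (S k) * r ^ k)).
  { apply Rmult_le_compat_l; auto.
    apply Rmult_le_compat_l; auto using pos_INR, Cmod_pow_le. }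
  lra.
Qed.

(** Second order in [w - z], with a constant whose growth in [k] is left uncontrolled; this serves
    finitely many terms. *)
Lemma taylor_remainder_quadratic (r : R) (k : nat) : 0 <= r ->
  exists M, 0 <= M /\ forall z w, Cmod z <= r -> Cmod w <= r ->
    Cmod (taylor_remainder k z w) <= M * Cmod (w - z)%C ^ 2.
Proof.
  intros Hr; induction k as [|k [M [HM IH]]].
  - exists 0; split; [lra|]; intros z w _ _; unfold taylor_remainder.
    replace (w ^ 1 - z ^ 1 - (w - z) * (INR 1 * z ^ 0))%C with (RtoC 0)
      by (simpl; ring).
    rewrite Cmod_0; lra.
  - exists (r * M + INR (S k) * r ^ k); split.
    { pose proof (pos_INR (S k)); pose proof (pow_le r k Hr); nra. }
    intros z w Hz Hw.
    replace (taylor_remainder (S k) z w) with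
      (w * taylor_remainder k z w + INR (S k) * z ^ k * (w - z) ^ 2)%C
      by (unfold taylor_remainder; rewrite (S_INR (S k)), RtoC_plus; simpl; ring).
    eapply Rle_trans; [apply Cmod_triangle|].
    rewrite !Cmod_mult, (Cmod_pow (w - z)%C), Cmod_R, (Rabs_pos_eq _ (pos_INR _)).
    assert (Cmod w * Cmod (taylor_remainder k z w) <= r * (M * Cmod (w - z)%C ^ 2))
      by (apply Rmult_le_compat; auto using Cmod_ge_0).
    assert (INR (S k) * Cmod (z ^ k)%C * Cmod (w - z)%C ^ 2
            <= INR (S k) * r ^ k * Cmod (w - z)%C ^ 2).
    { apply Rmult_le_compat_r; [apply pow2_ge_0|].
      apply Rmult_le_compat_l; auto using pos_INR, Cmod_pow_le. }
    lra.
Qed.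

Lemma Series_tail_small (b : nat -> R) (eps : R) : ex_series b -> 0 < eps ->
  exists N, Series (fun k => b (N + k)%nat) < eps.
Proof.
  intros Hb Heps.
  assert (H : is_lim_seq (sum_n b) (Series b)) by (apply (Series_correct b Hb)).
  apply is_lim_seq_spec in H; destruct (H (mkposreal eps Heps)) as [N HN].
  exists (S N); specialize (HN N (le_n N)); simpl in HN.
  rewrite sum_n_Reals in HN.
  rewrite (Series_incr_n b (S N)) in HN by (lia || assumption); simpl in HN.
  unfold Rabs in HN; destruct Rcase_abs in HN; simpl in *; lra.
Qed.

(** The sum is cut at an index [N]. The tail is small relative to [w - z] by the linear bound and
    the summability of the derived series; the head is quadratic in [w - z], hence small once
    [delta] is. *)
Lemma taylor_remainder_sum_small (c : nat -> C) (r eps : R) :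
  0 <= r -> 0 < eps -> ex_series (fun k => Cmod (dcoef c k) * r ^ k) ->
  exists delta, 0 < delta /\ forall z w, Cmod z <= r -> Cmod w <= r ->
    Cmod (w - z)%C < delta ->
    Cmod (CSeries (fun k => (c (S k) * taylor_remainder k z w)%C)) <= eps * Cmod (w - z)%C.
Proof.
  intros Hr Heps Hd.
  set (b := fun k => Cmod (dcoef c k) * r ^ k) in Hd.
  (* The 8 is made of the 2 of the linear bound, the 2 of [Cmod_CSeries_le], and a 2 for sharing
     [eps] between head and tail. *)
  destruct (Series_tail_small b (eps / 8) Hd) as [N HN]; [lra|].
  assert (Hhead : exists M, 0 <= M /\ forall z w, Cmod z <= r -> Cmod w <= r ->
    forall k, (k < N)%nat ->
    Cmod (c (S k) * taylor_remainder k z w)%C <= M * Cmod (w - z)%C ^ 2).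
  { clear HN; induction N as [|N [M [HM IH]]].
    - exists 0; split; [lra|]; intros; lia.
    - destruct (taylor_remainder_quadratic r N Hr) as [M' [HM' HT]].
      exists (M + Cmod (c (S N)) * M'); split.
      { pose proof (Cmod_ge_0 (c (S N))); nra. }
      intros z w Hz Hw k Hk.
      pose proof (Cmod_ge_0 (c (S N))); pose proof (pow2_ge_0 (Cmod (w - z)%C)).
      destruct (Nat.eq_dec k N) as [->|Hne].
      + rewrite Cmod_mult; specialize (HT z w Hz Hw).
        apply Rle_trans with (Cmod (c (S N)) * (M' * Cmod (w - z)%C ^ 2)); [nra|nra].
      + eapply Rle_trans; [apply IH; auto; lia|].
        apply Rmult_le_compat_r; nra. }
  destruct Hhead as [M [HM Hhead]].
  (* From [h * D <= eps] follows [INR N * M * h <= eps / 4], the share of the head; the [+ 1] keeps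
     [D] positive when the head is empty. *)
  set (D := 4 * (INR N * M + 1)).
  assert (HD : 0 < D) by (unfold D; pose proof (pos_INR N); nra).
  exists (eps / D); split; [apply Rdiv_lt_0_compat; lra|].
  intros z w Hz Hw Hzw; set (h := Cmod (w - z)%C) in *.
  assert (Hh : 0 <= h) by apply Cmod_ge_0.
  set (g := fun k => Cmod (c (S k) * taylor_remainder k z w)%C).
  assert (Hg : forall k, g k <= 2 * h * b k).
  { intros k; unfold g, b, dcoef; rewrite !Cmod_mult, Cmod_R, (Rabs_pos_eq _ (pos_INR _)).
    pose proof (taylor_remainder_linear r z w k Hz Hw); fold h in H.
    pose proof (Cmod_ge_0 (c (S k))).
    apply Rle_trans with (Cmod (c (S k)) * (2 * (INR (S k) * r ^ k) * h)); [nra|].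
    apply Req_le; ring. }
  assert (Hb2 : ex_series (fun k => 2 * h * b k))
    by apply (ex_series_scal (V := R_NormedModule) (2 * h) _ Hd).
  assert (Hgs : ex_series g).
  { apply (ex_series_le (V := R_CompleteNormedModule) _ (fun k => 2 * h * b k)); auto.
    intros k; change (Rabs (g k) <= 2 * h * b k).
    rewrite Rabs_pos_eq; [apply Hg|apply Cmod_ge_0]. }
  eapply Rle_trans; [apply (Cmod_CSeries_le _ g Hgs); intros k; apply Rle_refl|].
  assert (Htail : Series (fun k => g (N + k)%nat) <= eps / 4 * h).
  { apply Rle_trans with (Series (fun k => 2 * h * b (N + k)%nat)).
    - apply Series_le.
      + intros k; split; [apply Cmod_ge_0|apply Hg].
      + apply (ex_series_incr_n (fun k => 2 * h * b k)), Hb2.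
    - rewrite Series_scal_l; nra. }
  assert (Hfin : Series g <= INR N * (M * h ^ 2) + eps / 4 * h).
  { destruct N as [|N].
    - simpl in Htail |- *; change (fun k => g k) with g in Htail; lra.
    - rewrite (Series_incr_n g (S N)) by (lia || assumption).
      apply Rplus_le_compat; [|exact Htail]; simpl pred.
      assert (forall m, (m <= N)%nat -> sum_f_R0 g m <= INR (S m) * (M * h ^ 2)).
      { induction m as [|m IHm]; intros Hm.
        - simpl sum_f_R0; simpl INR; rewrite Rmult_1_l; apply Hhead; auto; lia.
        - simpl sum_f_R0; rewrite (S_INR (S m)).
          pose proof (Hhead z w Hz Hw (S m)) as Hx; fold h in Hx.
          specialize (IHm ltac:(lia)); specialize (Hx ltac:(lia)).
          unfold g at 2; lra. }
      apply H; lia. }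
  assert (INR N * M * h <= eps / 4).
  { assert (h * D <= eps) by (apply Rlt_le, Rlt_div_r; assumption).
    unfold D in H; pose proof (pos_INR N); nra. }
  apply Rle_trans with (2 * (INR N * M * h * h + eps / 4 * h)); [apply Rmult_le_compat_l; [lra|]|].
  - eapply Rle_trans; [exact Hfin|]; apply Req_le; ring.
  - nra.
Qed.

Lemma Cpseries_abs_summable (c : nat -> C) (r : R) (z : C) :
  ex_series (fun k => Cmod (c k) * r ^ k) -> Cmod z <= r ->
  abs_summable (fun k => (c k * z ^ k)%C).
Proof.
  intros H Hz; apply (abs_summable_le _ _ H).
  intros k; rewrite Cmod_mult; apply Rmult_le_compat_l; auto using Cmod_ge_0, Cmod_pow_le.
Qed.

Lemma dcoef_summable (c : nat -> C) (r : R) : 0 <= r ->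
  ex_series (fun k => Cmod (dcoef c k) * r ^ k) -> ex_series (fun k => Cmod (c k) * r ^ k).
Proof.
  intros Hr H; apply ex_series_incr_1.
  apply (ex_series_le (V := R_CompleteNormedModule) _
    (fun k => r * (Cmod (dcoef c k) * r ^ k)));
    [|apply (ex_series_scal (V := R_NormedModule) r _ H)].
  intros k; pose proof (Cmod_ge_0 (c (S k))); pose proof (pow_le r k Hr).
  change (Rabs (Cmod (c (S k)) * r ^ S k) <= r * (Cmod (dcoef c k) * r ^ k)).
  rewrite Rabs_pos_eq by (apply Rmult_le_pos; auto using pow_le).
  unfold dcoef; rewrite Cmod_mult, Cmod_R, (Rabs_pos_eq _ (pos_INR _)), S_INR; simpl.
  pose proof (pos_INR k).
  assert (0 <= r * r ^ k * (INR k * Cmod (c (S k)))) by (repeat apply Rmult_le_pos; auto).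
  lra.
Qed.

Lemma locally_Cmod_lt (z : C) (d : R) : 0 < d ->
  locally (T := C_UniformSpace) z (fun w => Cmod (w - z)%C < d).
Proof.
  intros Hd.
  exact (locally_le_locally_norm (V := C_NormedModule) z _
    (ex_intro _ (mkposreal d Hd) (fun w H => H))).
Qed.

(** [filterdiff] quantifies over all limits of the filter. Since [z] lies in [D], it belongs to
    every set of the filter, and no neighbourhood of another limit could exclude it. *)
Lemma is_filter_lim_within_self (D : C -> Prop) (z x : C) : D z ->
  is_filter_lim (T := AbsRing_NormedModule C_AbsRing)
    (within D (locally (T := C_UniformSpace) z)) x -> x = z.
Proof.
  intros HD H.
  destruct (Req_dec (Cmod (z - x)%C) 0) as [E|E].
  - apply Cmod_eq_0 in E.
    replace x with (z - (z - x))%C by ring; rewrite E; ring.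
  - assert (Hp : 0 < Cmod (z - x)%C) by (pose proof (Cmod_ge_0 (z - x)%C); lra).
    assert (Hl : locally (T := AbsRing_NormedModule C_AbsRing) x
                   (fun w => Cmod (w - x)%C < Cmod (z - x)%C))
      by (exists (mkposreal _ Hp); intros w Hw; exact Hw).
    specialize (H _ Hl); apply locally_singleton in H.
    specialize (H HD); lra.
Qed.

(** The radius [r] is shared by both cases: on the open disc it lies strictly between [Cmod z] and
    1, on the closed disc it is 1 and bounds every point of [D]. *)
Lemma Cpseries_is_derive_in (D : C -> Prop) (c : nat -> C) (r : R) (z : C) :
  0 <= r -> D z -> Cmod z <= r ->
  within D (locally (T := C_UniformSpace) z) (fun w => Cmod w <= r) ->
  ex_series (fun k => Cmod (dcoef c k) * r ^ k) ->
  is_C_derive_in D (Cpseries c) z (Cpseries (dcoef c) z).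
Proof.
  intros Hr HD Hz HDr Hd; split.
  - split.
    + intros x y; apply Cmult_plus_distr_r.
    + intros k x; symmetry; apply Cmult_assoc.
    + exists (Cmod (Cpseries (dcoef c) z) + 1); split.
      { pose proof (Cmod_ge_0 (Cpseries (dcoef c) z)); lra. }
      intros x; change (Cmod (x * Cpseries (dcoef c) z)%C
                        <= (Cmod (Cpseries (dcoef c) z) + 1) * Cmod x).
      rewrite Cmod_mult; pose proof (Cmod_ge_0 x); nra.
  - intros x Hx; apply (is_filter_lim_within_self D z x HD) in Hx; subst x.
    intros [eps Heps].
    destruct (taylor_remainder_sum_small c r eps Hr Heps Hd) as [delta [Hdelta HT]].
    eapply (filter_imp (F := locally (T := C_UniformSpace) z));
      [|exact (filter_and _ _ (locally_Cmod_lt z delta Hdelta) HDr)].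
    intros w [Hw HDw] HDww; specialize (HDw HDww).
    change (Cmod (Cpseries c w - Cpseries c z - (w - z) * Cpseries (dcoef c) z)%C
            <= eps * Cmod (w - z)%C).
    (* The remainder of the series is the series of the monomial remainders; all rearrangements are
       legitimate by absolute summability at radius [r]. *)
    replace (Cpseries c w - Cpseries c z - (w - z) * Cpseries (dcoef c) z)%C
      with (CSeries (fun k => (c (S k) * taylor_remainder k z w)%C)); [apply HT; auto|].
    symmetry.
    pose proof (dcoef_summable c r Hr Hd) as Hc.
    pose proof (Cpseries_abs_summable c r w Hc HDw) as Sw.
    pose proof (Cpseries_abs_summable c r z Hc Hz) as Sz.
    pose proof (Cpseries_abs_summable (dcoef c) r z Hd Hz) as Sd.
    pose proof (proj1 (ex_series_incr_1 _) Sw : abs_summable (fun k => (c (S k) * w ^ S k)%C)) as Sw'.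
    pose proof (proj1 (ex_series_incr_1 _) Sz : abs_summable (fun k => (c (S k) * z ^ S k)%C)) as Sz'.
    assert (Sd' : abs_summable (fun k => ((w - z) * (dcoef c k * z ^ k))%C)).
    { apply (abs_summable_le _ _ (ex_series_scal (V := R_NormedModule) (Cmod (w - z)%C) _ Sd)).
      intros k; rewrite Cmod_mult; apply Rle_refl. }
    unfold Cpseries.
    rewrite (CSeries_incr_1 _ Sw), (CSeries_incr_1 _ Sz), <- (CSeries_scal _ _ Sd').
    transitivity (CSeries (fun k => (c (S k) * w ^ S k - c (S k) * z ^ S k)
      - (w - z) * (dcoef c k * z ^ k))%C).
    + rewrite (CSeries_minus (fun k => (c (S k) * w ^ S k - c (S k) * z ^ S k)%C)), CSeries_minus; auto.
      * change (Cpow w 0) with (RtoC 1); change (Cpow z 0) with (RtoC 1); ring.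
      * apply (abs_summable_le _ _ (ex_series_plus (V := R_NormedModule) _ _ Sw' Sz')).
        intros k; eapply Rle_trans; [apply Cmod_triangle|rewrite Cmod_opp; apply Rle_refl].
    + apply CSeries_ext; intros k; unfold taylor_remainder, dcoef; ring.
Qed.

Lemma is_C_derive_n_in_ext (D : C -> Prop) (n : nat) (f g h : C -> C) :
  (forall z, D z -> g z = h z) -> is_C_derive_n_in D f n g -> is_C_derive_n_in D f n h.
Proof.
  intros Hgh; revert f; induction n as [|n IH]; intros f; simpl.
  - intros H z Hz; rewrite (H z Hz); apply Hgh, Hz.
  - intros [f' [Hf Hf']]; exists f'; split; [exact Hf|apply IH, Hf'].
Qed.

Lemma Cpseries_is_derive_n_in (D : C -> Prop) (n : nat) (c : nat -> C) :
  (forall z, D z -> exists r, 0 <= r /\ Cmod z <= r /\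
     within D (locally (T := C_UniformSpace) z) (fun w => Cmod w <= r) /\
     ex_series (fun k => Cmod (Nat.iter n dcoef c k) * r ^ k)) ->
  is_C_derive_n_in D (Cpseries c) n (Cpseries (Nat.iter n dcoef c)).
Proof.
  revert c; induction n as [|n IH]; intros c H; [easy|].
  rewrite Nat.iter_succ_r in *; exists (Cpseries (dcoef c)); split.
  - intros z Hz; destruct (H z Hz) as (r & Hr & Hzr & Hl & Hs).
    apply Cpseries_is_derive_in with r; auto.
    (* Summability is given for the highest derived series only; it descends to the lower ones
       because differentiation never decreases the moduli of the shifted coefficients. *)
    revert Hs; generalize (dcoef c); clear - Hr; induction n as [|n IH]; intros d Hd; auto.
    apply IH, dcoef_summable, Hd; exact Hr.
  - apply IH, H.
Qed.

(** * Growth of coefficients *)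

(** The base is [INR k + 1] so that it is at least 1 from [k = 0] on, which makes the bound positive
    and monotone in the exponent. *)
Definition poly_bounded (c : nat -> C) (e : R) : Prop :=
  exists M, forall k, Cmod (c k) <= M * Rpower (INR k + 1) e.

Lemma Rpower_pos (x y : R) : 0 < Rpower x y.
Proof. apply exp_pos. Qed.

Lemma exp_le (x y : R) : x <= y -> exp x <= exp y.
Proof. intros [H| ->]; [left; apply exp_increasing, H|apply Rle_refl]. Qed.

Lemma poly_bounded_eventually (c : nat -> C) (e M : R) (K : nat) :
  (forall k, (K <= k)%nat -> Cmod (c k) <= M * Rpower (INR k + 1) e) -> poly_bounded c e.
Proof.
  revert M; induction K as [|K IH]; intros M H.
  - exists M; intros k; apply H; lia.
  - pose proof (Rpower_pos (INR K + 1) e) as HP.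
    apply (IH (Rmax M (Cmod (c K) / Rpower (INR K + 1) e))).
    intros k Hk; destruct (Nat.eq_dec k K) as [->|Hne].
    + apply Rle_trans with (Cmod (c K) / Rpower (INR K + 1) e * Rpower (INR K + 1) e).
      * apply Req_le; field; lra.
      * apply Rmult_le_compat_r; [lra|apply Rmax_r].
    + eapply Rle_trans; [apply H; lia|].
      apply Rmult_le_compat_r; [left; apply Rpower_pos|apply Rmax_l].
Qed.

Lemma poly_bounded_const_ge0 (c : nat -> C) (e M : R) :
  (forall k, Cmod (c k) <= M * Rpower (INR k + 1) e) -> 0 <= M.
Proof.
  intros H; specialize (H O); pose proof (Cmod_ge_0 (c O)).
  pose proof (Rpower_pos (INR 0 + 1) e); nra.
Qed.

Lemma poly_bounded_weaken (c : nat -> C) (e f : R) :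
  e <= f -> poly_bounded c e -> poly_bounded c f.
Proof.
  intros Hef [M H]; pose proof (poly_bounded_const_ge0 _ _ _ H) as HM.
  exists M; intros k; eapply Rle_trans; [apply H|].
  apply Rmult_le_compat_l; [exact HM|].
  pose proof (pos_INR k); apply Rle_Rpower; lra.
Qed.

Lemma poly_bounded_mult (c d : nat -> C) (e f : R) :
  poly_bounded c e -> poly_bounded d f -> poly_bounded (fun k => (c k * d k)%C) (e + f).
Proof.
  intros [M HM] [N HN]; exists (M * N); intros k.
  rewrite Cmod_mult, Rpower_plus.
  eapply Rle_trans; [apply Rmult_le_compat; auto using Cmod_ge_0|].
  apply Req_le; ring.
Qed.

Lemma poly_bounded_dcoef (c : nat -> C) (e : R) :
  poly_bounded c e -> poly_bounded (dcoef c) (e + 1).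
Proof.
  intros [M H]; pose proof (poly_bounded_const_ge0 _ _ _ H) as HM.
  (* The constant is 2 to the power |e|: passing from [k + 1] to [k + 2] changes the base by a
     factor between 1 and 2, whatever the sign of [e]. *)
  exists (M * exp (Rabs e * ln 2)); intros k; unfold dcoef.
  pose proof (pos_INR k) as Hk.
  rewrite Cmod_mult, Cmod_R, (Rabs_pos_eq _ (pos_INR _)), S_INR, Rpower_plus, Rpower_1 by lra.
  specialize (H (S k)); rewrite S_INR in H.
  assert (HR : Rpower (INR k + 1 + 1) e <= exp (Rabs e * ln 2) * Rpower (INR k + 1) e).
  { unfold Rpower; rewrite <- exp_plus; apply exp_le.
    assert (ln (INR k + 1) <= ln (INR k + 1 + 1)) by (apply ln_le; lra).
    assert (ln (INR k + 1 + 1) <= ln 2 + ln (INR k + 1))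
      by (rewrite <- ln_mult by lra; apply ln_le; lra).
    unfold Rabs; destruct Rcase_abs; nra. }
  pose proof (Cmod_ge_0 (c (S k))).
  apply Rle_trans with ((INR k + 1) * (M * (exp (Rabs e * ln 2) * Rpower (INR k + 1) e))).
  - apply Rmult_le_compat_l; [lra|].
    eapply Rle_trans; [exact H|]; apply Rmult_le_compat_l; assumption.
  - apply Req_le; ring.
Qed.

Lemma poly_bounded_iter_dcoef (n : nat) (c : nat -> C) (e : R) :
  poly_bounded c e -> poly_bounded (Nat.iter n dcoef c) (e + INR n).
Proof.
  intros H; induction n as [|n IH].
  - simpl; rewrite Rplus_0_r; exact H.
  - rewrite S_INR, <- Rplus_assoc; apply (poly_bounded_dcoef _ _ IH).
Qed.

Lemma ex_series_inv_square : ex_series (fun k => / (INR k + 1) ^ 2).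
Proof.
  (* The majorant is 2 / ((k + 1) (k + 2)), written as a telescoping difference. *)
  apply (ex_series_le (V := R_CompleteNormedModule) _
    (fun k => 2 * (/ (INR k + 1) - / (INR k + 2)))).
  - intros k; pose proof (pos_INR k).
    change (Rabs (/ (INR k + 1) ^ 2) <= 2 * (/ (INR k + 1) - / (INR k + 2))).
    rewrite Rabs_pos_eq by (left; apply Rinv_0_lt_compat, pow_lt; lra).
    replace (2 * _) with (2 * / ((INR k + 1) * (INR k + 2))) by (field; lra).
    apply Rmult_le_reg_l with ((INR k + 1) ^ 2 * (INR k + 2)); [nra|].
    apply Rle_trans with (INR k + 2); [right; field; lra|].
    apply Rle_trans with (2 * (INR k + 1)); [lra|right; field; lra].
  - exists 2.
    assert (Hs : forall n, sum_n (fun k => 2 * (/ (INR k + 1) - / (INR k + 2))) n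
                           = 2 - 2 * / (INR n + 2)).
    { induction n as [|n IH].
      - rewrite sum_O; simpl; field.
      - rewrite sum_Sn, IH, S_INR.
        change (2 - 2 * / (INR n + 2) + 2 * (/ (INR n + 1 + 1) - / (INR n + 1 + 2))
                = 2 - 2 * / (INR n + 1 + 2)).
        pose proof (pos_INR n); field; lra. }
    apply (is_lim_seq_ext (fun n => 2 - 2 * / (INR n + 2)) _ 2); [intros n; symmetry; apply Hs|].
    replace (Finite 2) with (Finite (2 - 2 * 0)) by (f_equal; ring).
    apply is_lim_seq_minus'; [apply is_lim_seq_const|].
    apply (is_lim_seq_scal_l _ 2 0).
    apply (is_lim_seq_inv _ p_infty); [|easy].
    apply (is_lim_seq_plus _ _ p_infty 2 p_infty);
      [apply is_lim_seq_INR|apply is_lim_seq_const|easy].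
Qed.

Lemma poly_bounded_summable_1 (c : nat -> C) (e : R) :
  e <= -2 -> poly_bounded c e -> ex_series (fun k => Cmod (c k) * 1 ^ k).
Proof.
  intros He Hc; apply (poly_bounded_weaken _ _ _ He) in Hc; destruct Hc as [M H].
  apply (ex_series_le (V := R_CompleteNormedModule) _ (fun k => M * / (INR k + 1) ^ 2)).
  - intros k; pose proof (Cmod_ge_0 (c k)).
    change (Rabs (Cmod (c k) * 1 ^ k) <= M * / (INR k + 1) ^ 2).
    rewrite pow1, Rmult_1_r, Rabs_pos_eq by assumption.
    eapply Rle_trans; [apply H|]; apply Req_le; f_equal.
    pose proof (pos_INR k).
    rewrite <- Rpower_pow, <- Rpower_Ropp by lra; f_equal; simpl; ring.
  - apply (ex_series_scal (V := R_NormedModule) M), ex_series_inv_square.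
Qed.

Lemma Rpower_le_geometric (e s : R) : 1 < s ->
  exists M, 0 <= M /\ forall k, Rpower (INR k + 1) e <= M * s ^ k.
Proof.
  intros Hs; set (f := Rabs e + 1); set (L := ln s).
  assert (HL : 0 < L) by (unfold L; rewrite <- ln_1; apply ln_increasing; lra).
  assert (Hf : 0 < f) by (unfold f; pose proof (Rabs_pos e); lra).
  (* Here ln x <= x - 1 is applied at x = (k + 1) / A; this [A] makes the resulting slope f / A
     equal to ln s. *)
  set (A := f / L); assert (HA : 0 < A) by (apply Rdiv_lt_0_compat; assumption).
  exists (s * exp (f * ln A)); split; [pose proof (exp_pos (f * ln A)); nra|].
  intros k; pose proof (pos_INR k) as Hk.
  apply Rle_trans with (Rpower (INR k + 1) f).
  { apply Rle_Rpower; [lra|]; unfold f; pose proof (Rle_abs e); lra. }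
  replace (s * exp (f * ln A) * s ^ k) with (exp (f * ln A) * s ^ S k) by (simpl; ring).
  rewrite <- (Rpower_pow (S k) s) by lra.
  unfold Rpower; rewrite <- exp_plus; apply exp_le; fold L; rewrite S_INR.
  pose proof (exp_ineq1_le (ln ((INR k + 1) / A))) as Hi.
  rewrite exp_ln in Hi by (apply Rdiv_lt_0_compat; lra).
  unfold Rdiv in Hi; rewrite ln_mult, ln_Rinv in Hi by (try apply Rinv_0_lt_compat; lra).
  apply Rle_trans with (f * (ln A + (INR k + 1) * / A)).
  - apply Rmult_le_compat_l; lra.
  - apply Req_le; unfold A; field; lra.
Qed.

Lemma poly_bounded_summable_lt_1 (c : nat -> C) (e r : R) :
  0 < r < 1 -> poly_bounded c e -> ex_series (fun k => Cmod (c k) * r ^ k).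
Proof.
  intros Hr [M H]; pose proof (poly_bounded_const_ge0 _ _ _ H) as HM.
  (* The ratio lies strictly between 1 and 1 / r, so that its product with [r] is (1 + r) / 2, still
     below 1. *)
  assert (Hs : 1 < (1 + / r) / 2) by (pose proof (Rinv_lt_contravar r 1); rewrite Rinv_1 in *; lra).
  destruct (Rpower_le_geometric e _ Hs) as [N [HN HNk]].
  apply (ex_series_le (V := R_CompleteNormedModule) _ (fun k => M * N * ((1 + r) / 2) ^ k)).
  - intros k; pose proof (Cmod_ge_0 (c k)); pose proof (pow_le r k ltac:(lra)).
    change (Rabs (Cmod (c k) * r ^ k) <= M * N * ((1 + r) / 2) ^ k).
    rewrite Rabs_pos_eq by nra.
    replace ((1 + r) / 2) with ((1 + / r) / 2 * r) by (field; lra).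
    rewrite Rpow_mult_distr, <- Rmult_assoc; apply Rmult_le_compat_r; [assumption|].
    eapply Rle_trans; [apply H|]; rewrite Rmult_assoc; apply Rmult_le_compat_l; auto.
  - apply (ex_series_scal (V := R_NormedModule) (M * N)), ex_series_geom.
    rewrite Rabs_pos_eq; lra.
Qed.

Lemma INR_eventually_ge (x : R) : exists K, forall k, (K <= k)%nat -> x <= INR k.
Proof.
  destruct (INR_unbounded x) as [K HK]; exists K.
  intros k Hk; apply le_INR in Hk; lra.
Qed.

(** With n = k + 1, the left ratio is 1 + (Re g - 1) / n up to order 1 / n^2, while (1 + 1 / n)^e is
    1 + e / n up to the same order. The slack [eps] in [e] absorbs the second-order terms for large
    [k]. Iterating the ratio gives the growth of (g)_k / k!. *)
Lemma pochhammer_ratio_le (g : C) (eps : R) : 0 < eps ->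
  exists K, forall k, (K <= k)%nat ->
    Cmod (g + INR k)%C / (INR k + 1) * Rpower (INR k + 1) (Re g - 1 + eps)
    <= Rpower (INR (S k) + 1) (Re g - 1 + eps).
Proof.
  intros Heps; set (e := Re g - 1 + eps); set (q := Im g).
  (* The first summand makes [eps * n] dominate the second-order terms, the second keeps n + Re g -
     1 above n / 2. *)
  destruct (INR_eventually_ge ((Rabs e + q ^ 2) / eps + 2 * Rabs (Re g - 1) + 1)) as [K HK].
  exists K; intros k Hk; specialize (HK k Hk).
  set (n := INR k + 1) in *; replace (INR (S k) + 1) with (n + 1) by (rewrite S_INR; reflexivity).
  pose proof (pos_INR k); assert (Hn : 1 <= n) by (unfold n; lra).
  pose proof (Rabs_pos e); pose proof (Rabs_pos (Re g - 1)).
  assert (Hnn : 0 <= (Rabs e + q ^ 2) / eps)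
    by (apply Rdiv_le_0_compat; [pose proof (pow2_ge_0 q)|]; lra).
  assert (Hn1 : Rabs e + q ^ 2 <= eps * n).
  { apply Rle_trans with (eps * ((Rabs e + q ^ 2) / eps)); [apply Req_le; field; lra|].
    apply Rmult_le_compat_l; unfold n; lra. }
  assert (Hn2 : 2 * Rabs (Re g - 1) <= n) by (unfold n; lra).
  set (h := / n).
  assert (Hh : 0 < h) by (apply Rinv_0_lt_compat; lra).
  assert (Hnh : n * h = 1) by (apply Rinv_r; lra).
  assert (Hh1 : h <= 1) by nra.
  assert (Hng : n <= 2 * (n + (Re g - 1)))
    by (pose proof (Rabs_maj2 (Re g - 1)); lra).
  assert (Hq : 0 <= q ^ 2 * h) by (apply Rmult_le_pos; [apply pow2_ge_0|lra]).
  (* With A = n + Re g - 1 >= n / 2, the square of A + q^2 / n is at least A^2 + 2 A q^2 / n, hence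
     at least A^2 + q^2. *)
  assert (Hmod : Cmod (g + INR k)%C <= n + (Re g - 1) + q ^ 2 * h).
  { unfold Cmod; rewrite <- (sqrt_pow2 (n + (Re g - 1) + q ^ 2 * h)).
    2: lra.
    apply sqrt_le_1_alt.
    replace (fst (g + INR k)%C) with (n + (Re g - 1)) by (unfold n, Re; simpl; ring).
    replace (snd (g + INR k)%C) with q by (unfold q, Im; simpl; ring).
    assert (1 <= 2 * h * (n + (Re g - 1))) by nra.
    pose proof (pow2_ge_0 q); pose proof (pow2_ge_0 (q ^ 2 * h)); nra. }
  assert (Hratio : Cmod (g + INR k)%C / n <= 1 + e * h - Rabs e * h ^ 2).
  { apply Rle_trans with ((n + (Re g - 1) + q ^ 2 * h) * h).
    - apply (Rmult_le_compat_r h); lra.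
    - assert ((Rabs e + q ^ 2) * h ^ 2 <= eps * n * h ^ 2)
        by (apply Rmult_le_compat_r; [apply pow2_ge_0|exact Hn1]).
      replace (eps * n * h ^ 2) with (eps * (n * h) * h) in H2 by ring.
      rewrite Hnh in H2.
      replace ((n + (Re g - 1) + q ^ 2 * h) * h) with (n * h + (Re g - 1) * h + q ^ 2 * h ^ 2) by ring.
      rewrite Hnh; unfold e at 1; lra. }
  assert (Hln : Rpower (n + 1) e = Rpower (1 + h) e * Rpower n e).
  { rewrite Rpower_mult_distr by lra; f_equal.
    rewrite Rmult_plus_distr_r, Rmult_1_l, (Rmult_comm h), Hnh; reflexivity. }
  rewrite Hln; apply Rmult_le_compat_r; [left; apply Rpower_pos|].
  eapply Rle_trans; [exact Hratio|].
  eapply Rle_trans; [|apply exp_ineq1_le].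
  (* The exponential is now replaced by 1 + e ln (1 + h). The upper bound on ln (1 + h) serves
     negative [e], the lower bound nonnegative [e]; either way the defect is at most |e| h^2. *)
  assert (Hup : ln (1 + h) <= h).
  { pose proof (exp_ineq1_le (ln (1 + h))); rewrite exp_ln in *; lra. }
  assert (Hlo : h - h ^ 2 <= ln (1 + h)).
  { pose proof (exp_ineq1_le (ln (/ (1 + h)))) as Hi.
    rewrite exp_ln in Hi by (apply Rinv_0_lt_compat; lra).
    rewrite ln_Rinv in Hi by lra.
    assert (/ (1 + h) <= 1 - h + h ^ 2).
    { apply Rmult_le_reg_r with (1 + h); [lra|]; rewrite Rinv_l by lra; nra. }
    lra. }
  unfold Rabs; destruct Rcase_abs; nra.
Qed.

Lemma pochhammer_div_fact_poly_bounded (g : C) (eps : R) : 0 < eps ->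
  poly_bounded (fun k => (pochhammer g k / INR (fact k))%C) (Re g - 1 + eps).
Proof.
  intros Heps; destruct (pochhammer_ratio_le g eps Heps) as [K HK].
  set (e := Re g - 1 + eps) in *; set (x := fun k => (pochhammer g k / INR (fact k))%C).
  pose proof (Rpower_pos (INR K + 1) e) as HP.
  apply (poly_bounded_eventually _ e (Cmod (x K) / Rpower (INR K + 1) e) K).
  induction k as [|k IH]; intros Hk.
  - replace K with O by lia; apply Req_le; field.
    pose proof (Rpower_pos (INR 0 + 1) e); lra.
  - destruct (Nat.eq_dec (S k) K) as [<-|Hne].
    { apply Req_le; fold (x (S k)); field; pose proof (Rpower_pos (INR (S k) + 1) e); lra. }
    specialize (IH ltac:(lia)); specialize (HK k ltac:(lia)).
    assert (Hx : x (S k) = (x k * ((g + INR k) / (INR k + 1)%R))%C).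
    { unfold x; simpl pochhammer; rewrite fact_simpl, mult_INR, S_INR, RtoC_mult.
      pose proof (pos_INR k).
      field; split; apply RtoC_inj_neq || (intros E; apply RtoC_inj in E); try lra.
      apply (INR_fact_neq_0 k), E. }
    fold (x (S k)); rewrite Hx, Cmod_mult, Cmod_div, Cmod_R, Rabs_pos_eq.
    2: pose proof (pos_INR k); lra.
    2: { intros E; apply RtoC_inj in E; pose proof (pos_INR k); lra. }
    assert (0 <= Cmod (x K) / Rpower (INR K + 1) e)
      by (apply Rdiv_le_0_compat; auto using Cmod_ge_0).
    eapply Rle_trans; [apply Rmult_le_compat_r; [|exact IH]|].
    { pose proof (pos_INR k); apply Rdiv_le_0_compat; [apply Cmod_ge_0|lra]. }
    rewrite Rmult_assoc; apply Rmult_le_compat_l; [assumption|].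
    rewrite Rmult_comm; exact HK.
Qed.

Lemma Carg_bound (w : C) : Rabs (Carg w) <= PI.
Proof.
  unfold Carg; pose proof (acos_bound (Re w / Cmod w)).
  destruct Rle_dec; [|rewrite Rabs_Ropp]; rewrite Rabs_pos_eq; lra.
Qed.

Lemma Cmod_Cexp (z : C) : Cmod (Cexp z) = exp (Re z).
Proof.
  unfold Cexp, Cmod; simpl fst; simpl snd.
  replace ((exp (Re z) * cos (Im z)) ^ 2 + (exp (Re z) * sin (Im z)) ^ 2)
    with (exp (Re z) ^ 2 * (Rsqr (sin (Im z)) + Rsqr (cos (Im z)))) by (unfold Rsqr; ring).
  rewrite sin2_cos2, Rmult_1_r; apply sqrt_pow2; left; apply exp_pos.
Qed.

Lemma Cexp_neq_0 (z : C) : Cexp z <> 0.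
Proof. apply Cmod_gt_0; rewrite Cmod_Cexp; apply exp_pos. Qed.

(** The modulus of w^s is |w|^(Re s) exp (- Im s arg w). The argument is bounded by pi, and for
    large [k] the modulus of k + a agrees with k + 1 up to a factor 2. An index where k + a vanishes
    is among the finitely many discarded. *)
Lemma inv_Cpower_poly_bounded (a s : C) :
  poly_bounded (fun k => (/ Cpower (INR k + a) s)%C) (- Re s).
Proof.
  destruct (INR_eventually_ge (2 * (Cmod a + 1))) as [K HK].
  apply (poly_bounded_eventually _ _ (exp (Rabs (Re s) * ln 2 + Rabs (Im s) * PI)) K).
  intros k Hk; specialize (HK k Hk); pose proof (Cmod_ge_0 a).
  set (w := (INR k + a)%C).
  assert (Hup : Cmod w <= INR k + Cmod a).
  { eapply Rle_trans; [apply Cmod_triangle|]; rewrite Cmod_R, (Rabs_pos_eq _ (pos_INR _)); lra. }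
  assert (Hlo : INR k - Cmod a <= Cmod w).
  { pose proof (Cmod_triangle w (- a)%C) as Ht.
    replace (w + - a)%C with (RtoC (INR k)) in Ht by (unfold w; ring).
    rewrite Cmod_opp, Cmod_R, (Rabs_pos_eq _ (pos_INR _)) in Ht; lra. }
  assert (Hl1 : ln (Cmod w) <= ln 2 + ln (INR k + 1))
    by (rewrite <- ln_mult by lra; apply ln_le; lra).
  assert (Hl2 : ln (INR k + 1) <= ln 2 + ln (Cmod w))
    by (rewrite <- ln_mult by lra; apply ln_le; lra).
  unfold Cpower; rewrite Cmod_inv by apply Cexp_neq_0.
  rewrite Cmod_Cexp, <- exp_Ropp; unfold Rpower; rewrite <- exp_plus; apply exp_le.
  replace (Re (s * Clog w)%C) with (Re s * ln (Cmod w) - Im s * Carg w) by reflexivity.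
  assert (Im s * Carg w <= Rabs (Im s) * PI).
  { eapply Rle_trans; [apply Rle_abs|]; rewrite Rabs_mult.
    apply Rmult_le_compat_l; [apply Rabs_pos|apply Carg_bound]. }
  assert (Re s * (ln (INR k + 1) - ln (Cmod w)) <= Rabs (Re s) * ln 2).
  { eapply Rle_trans; [apply Rle_abs|]; rewrite Rabs_mult.
    apply Rmult_le_compat_l; [apply Rabs_pos|]; apply Rabs_le; lra. }
  lra.
Qed.

(** * Abel bounds for improper integrals *)

Notation is_CInt := (is_RInt (V := C_R_NormedModule)).
Notation ex_CInt := (ex_RInt (V := C_R_NormedModule)).
Notation CInt := (RInt (V := C_R_CompleteNormedModule)).
Notation is_CInt01 f := (is_RInt_gen (V := C_R_NormedModule) f (at_right 0) (at_left 1)).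
Notation CInt01 f := (RInt_gen (V := C_R_CompleteNormedModule) f (at_right 0) (at_left 1)).

Lemma CInt_correct (f : R -> C) (a b : R) : ex_CInt f a b -> is_CInt f a b (CInt f a b).
Proof. exact (RInt_correct (V := C_R_CompleteNormedModule) f a b). Qed.

Lemma is_CInt_unique (f : R -> C) (a b : R) (l : C) : is_CInt f a b l -> CInt f a b = l.
Proof. exact (is_RInt_unique (V := C_R_CompleteNormedModule) f a b l). Qed.

Lemma CInt_Chasles (f : R -> C) (a b c : R) : ex_CInt f a b -> ex_CInt f b c ->
  (CInt f a b + CInt f b c)%C = CInt f a c.
Proof. exact (RInt_Chasles (V := C_R_CompleteNormedModule) f a b c). Qed.

Lemma ex_CInt_sub (f : R -> C) (a b x y : R) : a <= x -> x <= y -> y <= b ->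
  ex_CInt f a b -> ex_CInt f x y.
Proof.
  intros H1 H2 H3 H.
  apply (ex_RInt_Chasles_2 (V := C_R_CompleteNormedModule) f a); [lra|].
  apply (ex_RInt_Chasles_1 (V := C_R_CompleteNormedModule) f a y b); [lra|exact H].
Qed.

Lemma is_CInt_mult (f : R -> C) (a b : R) (c l : C) :
  is_CInt f a b l -> is_CInt (fun t => (c * f t)%C) a b (c * l)%C.
Proof.
  intros H.
  pose proof (is_RInt_fct_extend_fst (U := R_NormedModule) (V := R_NormedModule) f a b l H) as H1.
  pose proof (is_RInt_fct_extend_snd (U := R_NormedModule) (V := R_NormedModule) f a b l H) as H2.
  apply (is_RInt_fct_extend_pair (U := R_NormedModule) (V := R_NormedModule)); simpl.
  - exact (is_RInt_minus _ _ _ _ _ _ (is_RInt_scal _ _ _ (fst c) _ H1)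
             (is_RInt_scal _ _ _ (snd c) _ H2)).
  - exact (is_RInt_plus _ _ _ _ _ _ (is_RInt_scal _ _ _ (fst c) _ H2)
             (is_RInt_scal _ _ _ (snd c) _ H1)).
Qed.

Lemma is_CInt_minus (f g : R -> C) (a b : R) (l m : C) :
  is_CInt f a b l -> is_CInt g a b m -> is_CInt (fun t => (f t - g t)%C) a b (l - m)%C.
Proof. exact (is_RInt_minus (V := C_R_NormedModule) f g a b l m). Qed.

Lemma norm_C_R (z : C) : norm (V := C_R_NormedModule) z = Cmod z.
Proof.
  change (sqrt (Rabs (fst z) ^ 2 + Rabs (snd z) ^ 2) = Cmod z).
  rewrite !pow2_abs; reflexivity.
Qed.

Lemma Cmod_CInt_le (f : R -> C) (a b M : R) (l : C) : a <= b ->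
  (forall x, a <= x <= b -> Cmod (f x) <= M) -> is_CInt f a b l -> Cmod l <= (b - a) * M.
Proof.
  intros Hab H Hl; rewrite <- norm_C_R.
  apply (norm_RInt_le_const (V := C_R_NormedModule) f a b l M Hab); [|exact Hl].
  intros x Hx; rewrite norm_C_R; apply H, Hx.
Qed.

Lemma ex_CInt_bounded (f : R -> C) (a b : R) : a <= b -> ex_CInt f a b ->
  exists M, 0 <= M /\ forall x, a <= x <= b -> Cmod (f x) <= M.
Proof.
  intros Hab H; destruct (ex_RInt_ub (V := C_R_NormedModule) f a b H) as [M HM].
  rewrite Rmin_left, Rmax_right in HM by assumption.
  assert (HM' : forall x, a <= x <= b -> Cmod (f x) <= M)
    by (intros x Hx; rewrite <- norm_C_R; apply HM, Hx).
  exists M; split; [|exact HM'].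
  eapply Rle_trans; [apply Cmod_ge_0|apply (HM' a); lra].
Qed.

(* The error term [M (y - x) / 2 ^ N] comes from freezing the weight on each of
   the [2 ^ N] pieces obtained by repeated bisection; the frozen sums are
   controlled by Abel summation. *)
Lemma abel_bisection (f : R -> C) (w v : R -> R) (a b K M : R) :
  ex_CInt f a b -> ex_CInt (fun t => (w t * f t)%C) a b ->
  (forall x y, a <= x -> x <= y -> y <= b -> Rabs (w y - w x) <= v y - v x) ->
  (forall x, a <= x <= b -> Cmod (CInt f x b) <= K) ->
  (forall x, a <= x <= b -> Cmod (f x) <= M) ->
  forall N x y, a <= x -> x <= y -> y <= b ->
  Cmod (CInt (fun t => (w t * f t)%C) x y - w x * CInt f x b + w y * CInt f y b)%C
    <= (v y - v x) * (K + M * ((y - x) / 2 ^ N)).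
Proof.
  intros Hf Hwf Hv HK HM N; induction N as [|N IH]; intros x y Hx Hxy Hy.
  - assert (Hfxy : ex_CInt f x y) by (apply (ex_CInt_sub f a b); assumption).
    assert (Hfyb : ex_CInt f y b) by (apply (ex_CInt_sub f a b); lra || assumption).
    assert (Hwxy : ex_CInt (fun t => (w t * f t)%C) x y)
      by (apply (ex_CInt_sub _ a b); assumption).
    rewrite <- (CInt_Chasles f x y b Hfxy Hfyb).
    set (I := CInt (fun t => (w t * f t)%C) x y).
    set (J := CInt f x y); set (S := CInt f y b).
    replace (I - w x * (J + S) + w y * S)%C
      with ((I - w x * J) + RtoC (w y - w x) * S)%C by (rewrite RtoC_minus; ring).
    eapply Rle_trans; [apply Cmod_triangle|].
    assert (H1 : Cmod (I - w x * J)%C <= (y - x) * ((v y - v x) * M)).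
    { apply (Cmod_CInt_le (fun t => (w t * f t - w x * f t)%C) x y); [assumption| |].
      - intros t Ht.
        replace (w t * f t - w x * f t)%C with (RtoC (w t - w x) * f t)%C
          by (rewrite RtoC_minus; ring).
        rewrite Cmod_mult, Cmod_R.
        apply Rmult_le_compat; [apply Rabs_pos|apply Cmod_ge_0| |apply HM; lra].
        pose proof (Hv x t Hx ltac:(lra) ltac:(lra)).
        pose proof (Hv t y ltac:(lra) ltac:(lra) Hy).
        pose proof (Rabs_pos (w y - w t)); lra.
      - apply is_CInt_minus; [apply CInt_correct, Hwxy|].
        apply is_CInt_mult, CInt_correct, Hfxy. }
    assert (H2 : Cmod (RtoC (w y - w x) * S)%C <= (v y - v x) * K).
    { rewrite Cmod_mult, Cmod_R; apply Rmult_le_compat; auto using Rabs_pos, Cmod_ge_0.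
      apply HK; lra. }
    simpl; lra.
  - set (m := (x + y) / 2).
    specialize (IH x m ltac:(lra) ltac:(unfold m; lra) ltac:(unfold m; lra)) as IH1.
    specialize (IH m y ltac:(unfold m; lra) ltac:(unfold m; lra) ltac:(lra)) as IH2.
    rewrite <- (CInt_Chasles (fun t => (w t * f t)%C) x m y)
      by (apply (ex_CInt_sub _ a b); unfold m; lra || assumption).
    replace ((m - x) / 2 ^ N) with ((y - x) / 2 ^ S N) in IH1
      by (unfold m; simpl; field; apply pow_nonzero; lra).
    replace ((y - m) / 2 ^ N) with ((y - x) / 2 ^ S N) in IH2
      by (unfold m; simpl; field; apply pow_nonzero; lra).
    match goal with |- Cmod ?Z <= _ => set (z := Z) end.
    match type of IH1 with Cmod ?Z <= _ => set (z1 := Z) in IH1 end.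
    match type of IH2 with Cmod ?Z <= _ => set (z2 := Z) in IH2 end.
    replace z with (z1 + z2)%C by (unfold z, z1, z2; ring).
    eapply Rle_trans; [apply Cmod_triangle|]; lra.
Qed.

(** Integration by parts with F(x) the integral of [f] from [x] to [b]: the integral of w f is w(a)
    F(a) plus that of F against dw. The function [v] dominates the variation of [w], and no
    differentiability of [w] enters. The bisection error vanishes as [N] grows. *)
Lemma abel_CInt_bound (f : R -> C) (w v : R -> R) (a b K : R) : a <= b ->
  ex_CInt f a b -> ex_CInt (fun t => (w t * f t)%C) a b ->
  (forall x y, a <= x -> x <= y -> y <= b -> Rabs (w y - w x) <= v y - v x) ->
  (forall x, a <= x <= b -> Cmod (CInt f x b) <= K) ->
  Cmod (CInt (fun t => (w t * f t)%C) a b) <= K * (Rabs (w a) + (v b - v a)).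
Proof.
  intros Hab Hf Hwf Hv HK.
  destruct (ex_CInt_bounded f a b Hab Hf) as [M [HM0 HM]].
  pose proof (abel_bisection f w v a b K M Hf Hwf Hv HK HM) as H.
  set (I := CInt (fun t => (w t * f t)%C) a b) in *.
  assert (Hbb : CInt f b b = RtoC 0)
    by exact (RInt_point (V := C_R_CompleteNormedModule) b f).
  assert (HN : Cmod (I - w a * CInt f a b)%C <= (v b - v a) * K).
  { apply le_epsilon; intros eps Heps.
    set (T := (v b - v a) * M * (b - a)).
    assert (HT : 0 <= T).
    { pose proof (Hv a b ltac:(lra) Hab ltac:(lra)); pose proof (Rabs_pos (w b - w a)).
      repeat apply Rmult_le_pos; lra. }
    destruct (pow_lt_1_zero (/ 2) ltac:(rewrite Rabs_pos_eq; lra) (eps / (T + 1))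
      ltac:(apply Rdiv_lt_0_compat; lra)) as [N HNN].
    specialize (HNN N (le_n N)); rewrite pow_inv in HNN.
    rewrite Rabs_pos_eq in HNN by (left; apply Rinv_0_lt_compat, pow_lt; lra).
    specialize (H N a b ltac:(lra) Hab ltac:(lra)); fold I in H.
    rewrite Hbb in H.
    replace (I - w a * CInt f a b)%C with (I - w a * CInt f a b + w b * 0)%C by ring.
    eapply Rle_trans; [exact H|].
    replace ((v b - v a) * (K + M * ((b - a) / 2 ^ N)))
      with ((v b - v a) * K + T * / 2 ^ N) by (unfold T; field; apply pow_nonzero; lra).
    apply Rplus_le_compat_l.
    apply Rle_trans with (T * (eps / (T + 1))); [apply Rmult_le_compat_l; lra|].
    apply Rmult_le_reg_r with (T + 1); [lra|].
    replace (T * (eps / (T + 1)) * (T + 1)) with (T * eps) by (field; lra); nra. }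
  replace I with ((I - w a * CInt f a b) + w a * CInt f a b)%C by ring.
  eapply Rle_trans; [apply Cmod_triangle|].
  rewrite Cmod_mult, Cmod_R.
  pose proof (HK a ltac:(lra)); pose proof (Rabs_pos (w a)).
  assert (Rabs (w a) * Cmod (CInt f a b) <= Rabs (w a) * K) by (apply Rmult_le_compat_l; assumption).
  lra.
Qed.

(** The bound [d < 1 / 2] forces [a < b], so that later interval arguments need no case on
    orientation. *)
Lemma is_CInt01_spec (f : R -> C) (l : C) :
  is_CInt01 f l <-> forall eps, 0 < eps -> exists d, 0 < d < 1 / 2 /\
    forall a b, 0 < a < d -> 1 - d < b < 1 -> exists I, is_CInt f a b I /\ Cmod (I - l)%C < eps.
Proof.
  split.
  - intros H eps Heps.
    pose proof (locally_Cmod_lt l eps Heps) as Hl.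
    specialize (H _ Hl); destruct H as [P Q [[d1 Hd1] HP] [[d2 Hd2] HQ] H].
    simpl in HP, HQ.
    exists (Rmin (Rmin d1 d2) (1 / 3)).
    pose proof (Rmin_l (Rmin d1 d2) (1 / 3)); pose proof (Rmin_r (Rmin d1 d2) (1 / 3)).
    pose proof (Rmin_l d1 d2); pose proof (Rmin_r d1 d2).
    split; [split; [repeat apply Rmin_glb_lt; lra|lra]|].
    intros a b Ha Hb; apply (H a b).
    + apply HP; [|lra]; change (Rabs (a - 0) < d1).
      rewrite Rminus_0_r, Rabs_pos_eq; lra.
    + apply HQ; [|lra]; change (Rabs (b - 1) < d2).
      rewrite Rabs_left; lra.
  - intros H P HP.
    apply (locally_norm_le_locally (V := C_R_NormedModule)) in HP.
    destruct HP as [[eps Heps] HP]; destruct (H eps Heps) as [d [Hd Hab]].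
    exists (fun a => 0 < a < d) (fun b => 1 - d < b < 1).
    + exists (mkposreal d (proj1 Hd)); intros y Hy Hy0.
      change (Rabs (y - 0) < d) in Hy; rewrite Rminus_0_r, Rabs_pos_eq in Hy; lra.
    + exists (mkposreal d (proj1 Hd)); intros y Hy Hy0.
      change (Rabs (y - 1) < d) in Hy; rewrite Rabs_left in Hy; lra.
    + intros a b Ha Hb; destruct (Hab a b Ha Hb) as [I [HI HIl]].
      exists I; split; [exact HI|apply HP; red; rewrite norm_C_R; exact HIl].
Qed.

Lemma is_CInt01_ex (f : R -> C) (l : C) (x y : R) :
  is_CInt01 f l -> 0 < x -> x <= y -> y < 1 -> ex_CInt f x y.
Proof.
  intros H Hx Hxy Hy; apply is_CInt01_spec with (eps := 1) in H; [|lra].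
  destruct H as [d [Hd H]].
  assert (0 < Rmin x (d / 2)) by (apply Rmin_glb_lt; lra).
  assert (Rmax y (1 - d / 2) < 1) by (apply Rmax_lub_lt; lra).
  pose proof (Rmin_r x (d / 2)); pose proof (Rmax_r y (1 - d / 2)).
  destruct (H (Rmin x (d / 2)) (Rmax y (1 - d / 2))) as [I [HI _]]; [lra|lra|].
  apply (ex_CInt_sub f (Rmin x (d / 2)) (Rmax y (1 - d / 2)));
    auto using Rmin_l, Rmax_l; exists I; exact HI.
Qed.

(** Integrals whose ends are close to 0 and 1 are close to [l], and on a fixed middle interval the
    integrand is bounded. Every other integral is a sum or difference of such ones, so conditional
    convergence suffices. *)
Lemma is_CInt01_bounded (f : R -> C) (l : C) : is_CInt01 f l ->
  exists K, forall x y, 0 < x -> x <= y -> y < 1 -> Cmod (CInt f x y) <= K.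
Proof.
  intros H; pose proof (fun x y => is_CInt01_ex f l x y H) as Hex.
  apply is_CInt01_spec with (eps := 1) in H; [|lra]; destruct H as [d [Hd H]].
  set (a := d / 2); set (b := 1 - d / 2).
  assert (Hl : forall x y, 0 < x < d -> 1 - d < y < 1 -> Cmod (CInt f x y) <= Cmod l + 1).
  { intros x y Hx Hy; destruct (H x y Hx Hy) as [I [HI HIl]].
    rewrite (is_CInt_unique _ _ _ _ HI).
    replace I with ((I - l) + l)%C by ring.
    eapply Rle_trans; [apply Cmod_triangle|lra]. }
  destruct (ex_CInt_bounded f a b) as [M [HM0 HM]];
    [unfold a, b; lra|apply Hex; unfold a, b; lra|].
  pose proof (Cmod_ge_0 l).
  assert (HM1 : forall x y, a <= x -> x <= y -> y <= b -> Cmod (CInt f x y) <= M).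
  { intros x y Hx Hxy Hy; apply Rle_trans with ((y - x) * M).
    - apply (Cmod_CInt_le f); [assumption|intros; apply HM; lra|].
      apply CInt_correct, Hex; unfold a, b in *; lra.
    - unfold a, b in *; nra. }
  set (B := 2 * (Cmod l + 1) + M).
  assert (Hup : forall x, 0 < x -> x <= b -> Cmod (CInt f x b) <= B).
  { intros x Hx Hxb; destruct (Rlt_le_dec x d).
    - eapply Rle_trans; [apply Hl; unfold b; lra|unfold B; lra].
    - eapply Rle_trans; [apply HM1; unfold a; lra|unfold B; lra]. }
  assert (Hdn : forall x, b <= x -> x < 1 -> Cmod (CInt f b x) <= B).
  { intros x Hbx Hx.
    replace (CInt f b x) with (CInt f a x - CInt f a b)%C.
    - eapply Rle_trans; [apply Cmod_triangle|]; rewrite Cmod_opp.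
      pose proof (Hl a x); pose proof (Hl a b); unfold a, b in *.
      assert (0 < d / 2 < d) by lra; unfold B; lra.
    - rewrite <- (CInt_Chasles f a b x); [ring|apply Hex; unfold a, b; lra|].
      apply Hex; unfold b in *; lra. }
  exists (B + B); intros x y Hx Hxy Hy.
  assert (0 <= B) by (unfold B; lra).
  assert (0 < b < 1) by (unfold b; lra).
  destruct (Rle_lt_dec y b); [|destruct (Rle_lt_dec b x)].
  - replace (CInt f x y) with (CInt f x b - CInt f y b)%C.
    + eapply Rle_trans; [apply Cmod_triangle|]; rewrite Cmod_opp.
      apply Rplus_le_compat; apply Hup; lra.
    + rewrite <- (CInt_Chasles f x y b); [ring|apply Hex; lra..].
  - replace (CInt f x y) with (CInt f b y - CInt f b x)%C.
    + eapply Rle_trans; [apply Cmod_triangle|]; rewrite Cmod_opp.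
      apply Rplus_le_compat; apply Hdn; lra.
    + rewrite <- (CInt_Chasles f b x y); [ring|apply Hex; lra..].
  - rewrite <- (CInt_Chasles f x b y) by (apply Hex; lra).
    eapply Rle_trans; [apply Cmod_triangle|].
    apply Rplus_le_compat; [apply Hup|apply Hdn]; lra.
Qed.

(** [K] is chosen before the weight: one convergent integral thus controls a whole family of
    weighted ones. The variation allowance 2 W fits a weight that rises to its maximum and falls
    again; with |w(a)| <= W it accounts for the factor 3. *)
Lemma abel_CInt01_bound (f : R -> C) (l : C) : is_CInt01 f l ->
  exists K, 0 <= K /\ forall (g : R -> C) (w v : R -> R) (W : R) (m : C),
    (forall t, 0 < t < 1 -> g t = (w t * f t)%C) ->
    (forall x y, 0 < x -> x <= y -> y < 1 -> Rabs (w y - w x) <= v y - v x <= 2 * W) ->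
    (forall x, 0 < x < 1 -> Rabs (w x) <= W) ->
    is_CInt01 g m -> Cmod m <= K * W.
Proof.
  intros Hf; destruct (is_CInt01_bounded f l Hf) as [K HK].
  assert (HK0 : 0 <= K)
    by (eapply Rle_trans; [apply Cmod_ge_0|apply (HK (1 / 2) (1 / 2)); lra]).
  exists (3 * K); split; [lra|]; intros g w v W m Hg Hv HW Hm.
  apply le_epsilon; intros eps Heps.
  apply is_CInt01_spec with (eps := eps) in Hm; [|exact Heps].
  destruct Hm as [d [Hd Hm]].
  destruct (Hm (d / 2) (1 - d / 2)) as [I [HI HIm]]; [lra|lra|].
  set (a := d / 2) in *; set (b := 1 - d / 2) in *.
  assert (Hab : 0 < a /\ a <= b /\ b < 1) by (unfold a, b; lra).
  assert (HI' : is_CInt (fun t => (w t * f t)%C) a b I).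
  { apply (is_RInt_ext g); [|exact HI]; intros t Ht.
    rewrite Rmin_left, Rmax_right in Ht by lra; apply Hg; lra. }
  pose proof (abel_CInt_bound f w v a b K ltac:(lra)
    (is_CInt01_ex f l a b Hf ltac:(lra) ltac:(lra) ltac:(lra)) (ex_intro _ I HI')) as Hb.
  rewrite (is_CInt_unique _ _ _ _ HI') in Hb.
  specialize (Hb ltac:(intros; apply Hv; lra) ltac:(intros; apply HK; lra)).
  pose proof (HW a ltac:(lra)); pose proof (Hv a b ltac:(lra) ltac:(lra) ltac:(lra)).
  assert (K * (Rabs (w a) + (v b - v a)) <= K * (3 * W)) by (apply Rmult_le_compat_l; lra).
  replace m with (I - (I - m))%C by ring.
  eapply Rle_trans; [apply Cmod_triangle|]; rewrite Cmod_opp; lra.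
Qed.

(** * The beta integral *)

Lemma Lub_Rbar_full : Lub_Rbar (fun _ => True) = p_infty.
Proof.
  apply is_lub_Rbar_unique; split; [intros x _; exact I|].
  intros [b| |] Hb; simpl; auto.
  - specialize (Hb (b + 1) I); simpl in Hb; lra.
  - exact (Hb 0 I).
Qed.

(* [iota] of an empty predicate is the limit of the improper filter, which is [0]. *)
Lemma CInt01_junk (f : R -> C) : (forall l, ~ is_CInt01 f l) -> CInt01 f = RtoC 0.
Proof.
  intros H.
  assert (HT : forall P : R -> Prop,
    (forall x : C, is_CInt01 f x -> P (Re x)) = True /\
    (forall x : C, is_CInt01 f x -> P (Im x)) = True)
    by (intros P; split; apply propositional_extensionality; split; auto;
        intros _ x Hx; destruct (H x Hx)).
  change (CInt01 f) with
    (R_complete_lim (fun P => forall x : C, is_CInt01 f x -> P (Re x)),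
     R_complete_lim (fun P => forall x : C, is_CInt01 f x -> P (Im x))).
  unfold R_complete_lim, RtoC; f_equal;
    (transitivity (real (Lub_Rbar (fun _ => True))); [|rewrite Lub_Rbar_full; reflexivity]);
    f_equal; f_equal; apply functional_extensionality; intros x; apply HT.
Qed.

Lemma CInt01_unique (f : R -> C) (l : C) : is_CInt01 f l -> CInt01 f = l.
Proof. apply (is_RInt_gen_unique (V := C_R_CompleteNormedModule)). Qed.

Lemma is_CInt01_mult (f : R -> C) (c l : C) :
  is_CInt01 f l -> is_CInt01 (fun t => (c * f t)%C) (c * l)%C.
Proof.
  rewrite !is_CInt01_spec; intros H eps Heps.
  pose proof (Cmod_ge_0 c).
  destruct (H (eps / (Cmod c + 1))) as [d [Hd Hab]]; [apply Rdiv_lt_0_compat; lra|].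
  exists d; split; [exact Hd|]; intros a b Ha Hb.
  destruct (Hab a b Ha Hb) as [I [HI HIl]].
  exists (c * I)%C; split; [apply is_CInt_mult, HI|].
  replace (c * I - c * l)%C with (c * (I - l))%C by ring; rewrite Cmod_mult.
  apply Rlt_div_r in HIl; [|lra].
  pose proof (Cmod_ge_0 (I - l)%C); nra.
Qed.

Lemma is_CInt01_minus (f g : R -> C) (l m : C) : is_CInt01 f l -> is_CInt01 g m ->
  is_CInt01 (fun t => (f t - g t)%C) (l - m)%C.
Proof. apply (is_RInt_gen_minus (V := C_R_NormedModule)). Qed.

Lemma is_CInt01_ext (f g : R -> C) (l : C) :
  (forall t, 0 < t < 1 -> f t = g t) -> is_CInt01 f l -> is_CInt01 g l.
Proof.
  rewrite !is_CInt01_spec; intros Hfg H eps Heps.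
  destruct (H eps Heps) as [d [Hd Hab]]; exists d; split; [exact Hd|].
  intros a b Ha Hb; destruct (Hab a b Ha Hb) as [I [HI HIl]]; exists I; split; [|exact HIl].
  apply (is_RInt_ext f); [|exact HI]; intros t Ht.
  rewrite Rmin_left, Rmax_right in Ht by lra; apply Hfg; lra.
Qed.

(** * Complex powers of positive reals and the shift of the exponents *)

Lemma Cexp_plus (z w : C) : Cexp (z + w) = (Cexp z * Cexp w)%C.
Proof.
  destruct z as [x y], w as [x' y']; unfold Cexp, Cplus, Cmult; simpl.
  rewrite exp_plus, cos_plus, sin_plus; f_equal; ring.
Qed.

Lemma Cexp_RtoC (x : R) : Cexp x = exp x.
Proof. unfold Cexp, RtoC; simpl; rewrite cos_0, sin_0; f_equal; ring. Qed.

Lemma Clog_pos (t : R) : 0 < t -> Clog t = ln t.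
Proof.
  intros Ht; unfold Clog, Carg; rewrite Cmod_R, Rabs_pos_eq by lra.
  simpl; destruct Rle_dec as [_|n]; [|destruct n; apply Rle_refl].
  unfold Rdiv; rewrite Rinv_r, acos_1 by lra; reflexivity.
Qed.

Lemma Cpower_pos (t : R) (s : C) : 0 < t -> Cpower t s = Cexp (s * ln t)%C.
Proof. intros Ht; unfold Cpower; rewrite Clog_pos by exact Ht; reflexivity. Qed.

Lemma Cpower_add (t : R) (s s' : C) : 0 < t ->
  Cpower t (s + s')%C = (Cpower t s * Cpower t s')%C.
Proof.
  intros Ht; rewrite !Cpower_pos, <- Cexp_plus by exact Ht; f_equal; ring.
Qed.

Lemma Cpower_RtoC (t d : R) : 0 < t -> Cpower t d = Rpower t d.
Proof. intros Ht; rewrite Cpower_pos, <- RtoC_mult, Cexp_RtoC by exact Ht; reflexivity. Qed.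

Lemma beta_integrand_shift (x y : C) (c d t : R) : 0 < t < 1 ->
  beta_integrand (x + c)%C y t
  = ((Rpower t c * Rpower (1 - t) d)%R * beta_integrand x (y - d)%C t)%C.
Proof.
  intros Ht; unfold beta_integrand.
  replace (x + c - 1)%C with ((x - 1) + c)%C by ring.
  replace (y - 1)%C with ((y - d - 1) + d)%C by ring.
  rewrite !Cpower_add, !Cpower_RtoC, RtoC_mult by lra.
  ring.
Qed.

Lemma ext_beta_integrand_shift (x y : C) (c d p lambda t : R) : 0 < t < 1 ->
  ext_beta_integrand (x + c)%C y p lambda t
  = ((Rpower t c * Rpower (1 - t) d)%R * ext_beta_integrand x (y - d)%C p lambda t)%C.
Proof.
  intros Ht; unfold ext_beta_integrand.
  rewrite (beta_integrand_shift x y c d) by exact Ht; ring.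
Qed.

(** The function t^x (1 - t)^y, whose derivative carries the recurrence of the beta integral. *)
Definition beta_primitive (x y : C) (t : R) : C := Cexp (x * ln t + y * ln (1 - t))%C.

Lemma beta_primitive_integrand (x y : C) (t : R) : 0 < t < 1 ->
  beta_primitive x y t = ((t * (1 - t))%R * beta_integrand x y t)%C.
Proof.
  intros Ht; unfold beta_primitive, beta_integrand.
  rewrite Cexp_plus, <- !Cpower_pos by lra.
  replace (Cpower t x) with (Cpower t ((x - 1) + 1%R)%C) by (f_equal; ring).
  replace (Cpower (1 - t)%R y) with (Cpower (1 - t)%R ((y - 1) + 1%R)%C) by (f_equal; ring).
  rewrite !Cpower_add, !Cpower_RtoC, !Rpower_1, RtoC_mult by lra; ring.
Qed.

Lemma is_CInt_beta_primitive (x y : C) (a b : R) : 0 < a -> a <= b -> b < 1 ->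
  is_CInt (fun t => ((x / t - y / (1 - t)%R) * beta_primitive x y t)%C) a b
    (beta_primitive x y b - beta_primitive x y a)%C.
Proof.
  intros Ha Hab Hb; destruct x as [x1 x2], y as [y1 y2].
  set (u := fun t => x1 * ln t + y1 * ln (1 - t)).
  set (v := fun t => x2 * ln t + y2 * ln (1 - t)).
  set (u' := fun t => x1 / t - y1 / (1 - t)).
  set (v' := fun t => x2 / t - y2 / (1 - t)).
  assert (HQ : forall t, beta_primitive (x1, x2) (y1, y2) t
    = (exp (u t) * cos (v t), exp (u t) * sin (v t))).
  { intros t; unfold beta_primitive, Cexp, u, v; simpl; f_equal; f_equal; f_equal; ring. }
  assert (Hdu : forall t, 0 < t < 1 -> is_derive u t (u' t))
    by (intros t Ht; unfold u, u'; auto_derive; [lra|field; lra]).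
  assert (Hdv : forall t, 0 < t < 1 -> is_derive v t (v' t))
    by (intros t Ht; unfold v, v'; auto_derive; [lra|field; lra]).
  assert (HDu : forall t, 0 < t < 1 -> Derive (fun s : R => u s) t = u' t)
    by (intros t Ht; apply is_derive_unique, Hdu, Ht).
  assert (HDv : forall t, 0 < t < 1 -> Derive (fun s : R => v s) t = v' t)
    by (intros t Ht; apply is_derive_unique, Hdv, Ht).
  assert (Hdu' : forall t, 0 < t < 1 -> ex_derive u' t)
    by (intros t Ht; unfold u'; auto_derive; lra).
  assert (Hdv' : forall t, 0 < t < 1 -> ex_derive v' t)
    by (intros t Ht; unfold v'; auto_derive; lra).
  (* With x ln t + y ln (1 - t) = u + i v, these are the coordinates of (u' + i v') exp (u + i
     v). *)
  apply (is_RInt_ext (V := C_R_NormedModule)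
    (fun t => (exp (u t) * (u' t * cos (v t) - v' t * sin (v t)),
               exp (u t) * (u' t * sin (v t) + v' t * cos (v t))))).
  { intros t Ht; rewrite Rmin_left, Rmax_right in Ht by lra; rewrite HQ.
    unfold u', v', Cmult, Cminus, Cplus, Copp, Cdiv, Cinv, Cmult; simpl.
    f_equal; field; repeat split; nra. }
  rewrite !HQ.
  assert (Hin : forall t, Rmin a b <= t <= Rmax a b -> 0 < t < 1)
    by (intros t; rewrite Rmin_left, Rmax_right by lra; lra).
  assert (Hexu : forall t, 0 < t < 1 -> ex_derive u t) by (intros t Ht; eexists; apply Hdu, Ht).
  assert (Hexv : forall t, 0 < t < 1 -> ex_derive v t) by (intros t Ht; eexists; apply Hdv, Ht).
  apply (is_RInt_fct_extend_pair (U := R_NormedModule) (V := R_NormedModule)); simpl.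
  - apply (is_RInt_derive (V := R_CompleteNormedModule) (fun t => exp (u t) * cos (v t)));
      intros t Ht; apply Hin in Ht.
    + auto_derive; [repeat split; auto|].
      rewrite (HDu t Ht), (HDv t Ht); ring.
    + apply (ex_derive_continuous (V := R_NormedModule)); auto_derive; repeat split; auto.
  - apply (is_RInt_derive (V := R_CompleteNormedModule) (fun t => exp (u t) * sin (v t)));
      intros t Ht; apply Hin in Ht.
    + auto_derive; [repeat split; auto|].
      rewrite (HDu t Ht), (HDv t Ht); ring.
    + apply (ex_derive_continuous (V := R_NormedModule)); auto_derive; repeat split; auto.
Qed.

Lemma Cmod_beta_primitive (x y : C) (t : R) :
  Cmod (beta_primitive x y t) = Rpower t (Re x) * Rpower (1 - t) (Re y).
Proof.
  unfold beta_primitive; rewrite Cmod_Cexp; unfold Rpower; rewrite <- exp_plus.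
  f_equal; destruct x, y; simpl; ring.
Qed.

Lemma Rpower_small (s eps : R) : 0 < s -> 0 < eps ->
  exists d, 0 < d < 1 / 2 /\ forall t, 0 < t < d -> Rpower t s < eps.
Proof.
  intros Hs Heps; pose proof (Rpower_pos eps (/ s)).
  exists (Rmin (Rpower eps (/ s)) (1 / 3)); split.
  - pose proof (Rmin_r (Rpower eps (/ s)) (1 / 3)); split; [apply Rmin_glb_lt|]; lra.
  - intros t Ht; pose proof (Rmin_l (Rpower eps (/ s)) (1 / 3)).
    apply Rlt_le_trans with (Rpower (Rpower eps (/ s)) s); [apply Rlt_Rpower_l; lra|].
    rewrite Rpower_mult, Rinv_l, Rpower_1; lra.
Qed.

Lemma Rpower_le_1 (t s : R) : 0 < t <= 1 -> 0 <= s -> Rpower t s <= 1.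
Proof.
  intros Ht Hs; replace 1 with (Rpower 1 s) by (unfold Rpower; rewrite ln_1, Rmult_0_r; apply exp_0).
  apply Rle_Rpower_l; lra.
Qed.

(** The integrand is the derivative of t^x (1 - t)^y, because (x / t - y / (1 - t)) t (1 - t) = x -
    (x + y) t. The boundary values tend to 0 since both real parts are positive. *)
Lemma is_CInt01_beta_primitive (x y : C) : 0 < Re x -> 0 < Re y ->
  is_CInt01 (fun t => (x * beta_integrand x y t - (x + y) * beta_integrand (x + 1)%C y t)%C)
    (RtoC 0).
Proof.
  intros Hx Hy.
  apply (is_CInt01_ext (fun t => ((x / t - y / (1 - t)%R) * beta_primitive x y t)%C)).
  { intros t Ht; rewrite beta_primitive_integrand by exact Ht.
    rewrite (beta_integrand_shift x y 1 0 t Ht).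
    replace (y - 0)%C with y by ring.
    rewrite Rpower_O, Rpower_1, Rmult_1_r, RtoC_mult, !RtoC_minus by lra; field.
    split; [change (RtoC 1 - t <> 0)%C; rewrite <- RtoC_minus|];
      intros E; apply RtoC_inj in E; lra. }
  apply is_CInt01_spec; intros eps Heps.
  destruct (Rpower_small (Re x) (eps / 2) Hx ltac:(lra)) as [d1 [Hd1 H1]].
  destruct (Rpower_small (Re y) (eps / 2) Hy ltac:(lra)) as [d2 [Hd2 H2]].
  pose proof (Rmin_l d1 d2); pose proof (Rmin_r d1 d2).
  exists (Rmin d1 d2); split; [split; [apply Rmin_glb_lt|]; lra|].
  intros a b Ha Hb; eexists; split; [apply is_CInt_beta_primitive; lra|].
  replace (beta_primitive x y b - beta_primitive x y a - 0)%C
    with (beta_primitive x y b + - beta_primitive x y a)%C by ring.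
  eapply Rle_lt_trans; [apply Cmod_triangle|]; rewrite Cmod_opp, !Cmod_beta_primitive.
  pose proof (H1 a ltac:(lra)); pose proof (H2 (1 - b) ltac:(lra)).
  pose proof (Rpower_le_1 (1 - a) (Re y) ltac:(lra) ltac:(lra)).
  pose proof (Rpower_le_1 b (Re x) ltac:(lra) ltac:(lra)).
  pose proof (Rpower_pos a (Re x)); pose proof (Rpower_pos (1 - a) (Re y)).
  pose proof (Rpower_pos b (Re x)); pose proof (Rpower_pos (1 - b) (Re y)).
  nra.
Qed.

Lemma Re_pos_neq_0 (x : C) : 0 < Re x -> x <> 0.
Proof. intros H ->; simpl in H; lra. Qed.

(* The identity also holds between the junk values, hence no need to know that
   the integrals converge. *)
Lemma Beta_succ (x y : C) : 0 < Re x -> 0 < Re y ->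
  (Beta (x + 1) y * (x + y))%C = (x * Beta x y)%C.
Proof.
  intros Hx Hy.
  pose proof (is_CInt01_beta_primitive x y Hx Hy) as HD.
  assert (Hx0 : x <> 0) by (apply Re_pos_neq_0, Hx).
  assert (Hxy0 : (x + y)%C <> 0).
  { apply Re_pos_neq_0; destruct x, y; simpl in *; lra. }
  unfold Beta.
  destruct (classic (exists l, is_CInt01 (beta_integrand x y) l)) as [[l Hl]|Hno].
  - rewrite (CInt01_unique _ _ Hl).
    assert (Hs : is_CInt01 (beta_integrand (x + 1)%C y) (/ (x + y) * (x * l - 0))%C).
    { apply (is_CInt01_ext (fun t => (/ (x + y) * (x * beta_integrand x y t -
        (x * beta_integrand x y t - (x + y) * beta_integrand (x + 1)%C y t)))%C)).
      - intros t _; field; exact Hxy0.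
      - apply is_CInt01_mult, is_CInt01_minus; [apply is_CInt01_mult, Hl|exact HD]. }
    rewrite (CInt01_unique _ _ Hs); field; exact Hxy0.
  - rewrite (CInt01_junk (beta_integrand x y)) by (intros l Hl; apply Hno; exists l; exact Hl).
    (* The recurrence read backwards: convergence at [x + 1] would give convergence at [x]. The
       factor [- (1)] lets a sum pass as a difference. *)
    rewrite CInt01_junk; [ring|]; intros l Hl; apply Hno; exists (/ x * ((x + y) * l - (- (1)) * 0))%C.
    apply (is_CInt01_ext (fun t => (/ x * ((x + y) * beta_integrand (x + 1)%C y t - (- (1)) *
      (x * beta_integrand x y t - (x + y) * beta_integrand (x + 1)%C y t)))%C)).
    + intros t _; field; exact Hx0.
    + apply is_CInt01_mult, is_CInt01_minus; apply is_CInt01_mult; assumption.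
Qed.

Lemma pochhammer_neq_0 (x : C) (n : nat) : 0 < Re x -> pochhammer x n <> 0.
Proof.
  intros Hx; induction n as [|n IH]; simpl.
  - intros E; apply RtoC_inj in E; lra.
  - apply Cmult_neq_0; [exact IH|]; apply Re_pos_neq_0.
    destruct x; simpl in *; pose proof (pos_INR n); lra.
Qed.

Lemma Beta_shift (x y : C) (n : nat) : 0 < Re x -> 0 < Re y ->
  (Beta (x + INR n) y * pochhammer (x + y) n)%C = (pochhammer x n * Beta x y)%C.
Proof.
  intros Hx Hy; induction n as [|n IH].
  - simpl pochhammer; change (INR 0) with 0; replace (x + 0)%C with x by ring; ring.
  - simpl pochhammer; rewrite S_INR, RtoC_plus.
    replace (x + (INR n + 1))%C with (x + INR n + 1)%C by ring.
    transitivity (Beta (x + INR n + 1) y * (x + INR n + y) * pochhammer (x + y) n)%C; [ring|].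
    rewrite Beta_succ; [|destruct x; simpl in *; pose proof (pos_INR n); lra|exact Hy].
    transitivity ((x + INR n) * (Beta (x + INR n) y * pochhammer (x + y) n))%C; [ring|].
    rewrite IH; ring.
Qed.

Lemma pochhammer_add (g : C) (n k : nat) :
  pochhammer g (n + k) = (pochhammer g n * pochhammer (g + INR n) k)%C.
Proof.
  induction k as [|k IH].
  - rewrite Nat.add_0_r; simpl; ring.
  - rewrite Nat.add_succ_r; simpl; rewrite IH, plus_INR, RtoC_plus; ring.
Qed.

(** * The extended beta function and the Hurwitz-Lerch coefficients *)

Definition beta_weight (c d t : R) : R := Rpower t c * Rpower (1 - t) d.

Lemma ln_sub_le (x y : R) : 0 < x -> 0 < y -> ln y - ln x <= (y - x) / x.
Proof.
  intros Hx Hy; pose proof (exp_ineq1_le (ln (y / x))) as H.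
  rewrite exp_ln in H by (apply Rdiv_lt_0_compat; assumption).
  unfold Rdiv in H; rewrite ln_mult, ln_Rinv in H by (try apply Rinv_0_lt_compat; assumption).
  replace ((y - x) / x) with (y * / x - 1) by (field; lra); lra.
Qed.

Lemma beta_weight_exp (c d t : R) : beta_weight c d t = exp (c * ln t + d * ln (1 - t)).
Proof. unfold beta_weight, Rpower; rewrite exp_plus; reflexivity. Qed.

(** The point c / (c + d) is where c / t - d / (1 - t) changes sign. The tangent inequality for ln
    at [y] and at [1 - y] replaces the study of this derivative. *)
Lemma beta_weight_increasing (c d x y : R) : 0 < c -> 0 < d ->
  0 < x -> x <= y -> y <= c / (c + d) -> beta_weight c d x <= beta_weight c d y.
Proof.
  intros Hc Hd Hx Hxy Hy; rewrite !beta_weight_exp; apply exp_le.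
  assert (Hyc : y * (c + d) <= c).
  { apply Rmult_le_compat_r with (r := c + d) in Hy; [|lra].
    replace (c / (c + d) * (c + d)) with c in Hy by (field; lra); exact Hy. }
  assert (Hy1 : y < 1) by nra.
  pose proof (ln_sub_le y x ltac:(lra) Hx).
  pose proof (ln_sub_le (1 - y) (1 - x) ltac:(lra) ltac:(lra)).
  assert (c * ((x - y) / y) + d * ((1 - x - (1 - y)) / (1 - y)) <= 0).
  { replace (c * ((x - y) / y) + d * ((1 - x - (1 - y)) / (1 - y)))
      with (- ((y - x) * (c - y * (c + d)) * / (y * (1 - y)))) by (field; lra).
    assert (0 < / (y * (1 - y))) by (apply Rinv_0_lt_compat; nra).
    assert (0 <= (y - x) * (c - y * (c + d)) * / (y * (1 - y)))
      by (repeat apply Rmult_le_pos; lra).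
    lra. }
  nra.
Qed.

Lemma beta_weight_sym (c d t : R) : beta_weight c d t = beta_weight d c (1 - t).
Proof.
  unfold beta_weight; replace (1 - (1 - t)) with t by ring; ring.
Qed.

Lemma beta_weight_decreasing (c d x y : R) : 0 < c -> 0 < d ->
  c / (c + d) <= x -> x <= y -> y < 1 -> beta_weight c d y <= beta_weight c d x.
Proof.
  intros Hc Hd Hx Hxy Hy; rewrite (beta_weight_sym c d x), (beta_weight_sym c d y).
  apply beta_weight_increasing; try lra.
  replace (d / (d + c)) with (1 - c / (c + d)) by (field; lra); lra.
Qed.

(** At the maximum t = c / (c + d) one has 1 - t = (d / c) t, so the value is (d / c)^d t^(c + d)
    with t <= 1. For c = k this is of order k^(-d). *)
Lemma beta_weight_max (c d : R) : 0 < c -> 0 < d ->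
  beta_weight c d (c / (c + d)) <= Rpower (d / c) d.
Proof.
  intros Hc Hd; rewrite beta_weight_exp; unfold Rpower; apply exp_le.
  assert (0 < d / c) by (apply Rdiv_lt_0_compat; assumption).
  assert (Ht : 0 < c / (c + d)) by (apply Rdiv_lt_0_compat; lra).
  replace (1 - c / (c + d)) with (d / c * (c / (c + d))) by (field; lra).
  rewrite ln_mult by assumption.
  assert (ln (c / (c + d)) <= 0).
  { rewrite <- ln_1; apply ln_le; [exact Ht|].
    apply Rmult_le_reg_r with (c + d); [lra|].
    replace (c / (c + d) * (c + d)) with c by (field; lra); lra. }
  nra.
Qed.

Lemma beta_weight_ge_0 (c d t : R) : 0 <= beta_weight c d t.
Proof. rewrite beta_weight_exp; left; apply exp_pos. Qed.

Lemma abel_beta_weight (f : R -> C) (l : C) : is_CInt01 f l ->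
  exists K, 0 <= K /\ forall (c d : R) (m : C), 0 < c -> 0 < d ->
    is_CInt01 (fun t => (beta_weight c d t * f t)%C) m -> Cmod m <= K * Rpower (d / c) d.
Proof.
  intros Hf; destruct (abel_CInt01_bound f l Hf) as [K [HK H]].
  exists K; split; [exact HK|]; intros c d m Hc Hd Hm.
  set (w := beta_weight c d) in *; set (s := c / (c + d)).
  set (W := w s).
  assert (Hs0 : 0 < s) by (apply Rdiv_lt_0_compat; lra).
  assert (Hs1 : s < 1).
  { unfold s; apply Rmult_lt_reg_r with (c + d); [lra|].
    replace (c / (c + d) * (c + d)) with c by (field; lra); lra. }
  assert (Hup : forall x y, 0 < x -> x <= y -> y <= s -> w x <= w y)
    by (intros; apply beta_weight_increasing; assumption).
  assert (Hdn : forall x y, s <= x -> x <= y -> y < 1 -> w y <= w x)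
    by (intros; apply beta_weight_decreasing; assumption).
  assert (Hw0 : forall x, 0 <= w x) by (intros; apply beta_weight_ge_0).
  assert (HwW : forall x, 0 < x < 1 -> w x <= W).
  { intros x Hx; destruct (Rle_dec x s); [apply Hup|apply Hdn]; lra. }
  apply Rle_trans with (K * W); [|apply Rmult_le_compat_l; [exact HK|apply beta_weight_max; assumption]].
  (* The third argument is the variation function of a unimodal weight: [w] itself up to the
     maximum, then its reflection at height [W]. *)
  apply (H (fun t => (w t * f t)%C) w (fun t => if Rle_dec t s then w t else 2 * W - w t)); auto.
  - intros x y Hx Hxy Hy; pose proof (Hw0 x); pose proof (Hw0 y).
    pose proof (HwW x ltac:(lra)); pose proof (HwW y ltac:(lra)).
    destruct (Rle_dec x s); destruct (Rle_dec y s); try lra.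
    + pose proof (Hup x y Hx Hxy ltac:(assumption)); rewrite Rabs_pos_eq; lra.
    + split; [apply Rabs_le|]; lra.
    + pose proof (Hdn x y ltac:(lra) Hxy Hy); rewrite Rabs_left1; lra.
  - intros x Hx; rewrite Rabs_pos_eq; auto.
Qed.

(** A divergent integral has the value 0, so only convergent ones need a bound. Any convergent index
    [k0] serves as reference: the later integrands are its multiples by t^(k - k0), which is
    monotone and at most 1. *)
Lemma ext_Beta_bounded (x y : C) (p lambda : R) :
  poly_bounded (fun k => ext_Beta (x + INR k) y p lambda) 0.
Proof.
  set (F := fun k t => ext_beta_integrand (x + INR k) y p lambda t).
  destruct (classic (exists k l, is_CInt01 (F k) l)) as [[k0 [l Hl]]|Hno].
  - destruct (abel_CInt01_bound (F k0) l Hl) as [K [HK H]].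
    apply (poly_bounded_eventually _ 0 K k0); intros k Hk; pose proof (pos_INR k).
    rewrite Rpower_O by lra.
    unfold ext_Beta; fold (F k).
    destruct (classic (exists m, is_CInt01 (F k) m)) as [[m Hm]|Hm].
    + rewrite (CInt01_unique _ _ Hm).
      set (c := INR (k - k0)).
      assert (Hc : 0 <= c) by apply pos_INR.
      apply (H (F k) (fun t => Rpower t c) (fun t => Rpower t c) 1); [| | |exact Hm].
      * intros t Ht; unfold F.
        replace (x + INR k)%C with (x + INR k0 + c)%C
          by (unfold c; rewrite minus_INR, RtoC_minus by assumption; ring).
        rewrite (ext_beta_integrand_shift _ _ c 0) by exact Ht.
        rewrite Rpower_O, Rmult_1_r by lra; do 2 f_equal; ring.
      * intros a b Ha Hab Hb.
        assert (Rpower a c <= Rpower b c) by (apply Rle_Rpower_l; lra).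
        pose proof (Rpower_le_1 b c ltac:(lra) Hc); pose proof (Rpower_pos a c).
        rewrite Rabs_pos_eq; lra.
      * intros t Ht; pose proof (Rpower_pos t c).
        rewrite Rabs_pos_eq by lra; apply Rpower_le_1; lra.
    + rewrite CInt01_junk by (intros m Hm'; apply Hm; exists m; exact Hm').
      rewrite Cmod_0; lra.
  - exists 0; intros k; unfold ext_Beta; fold (F k).
    rewrite CInt01_junk by (intros m Hm; apply Hno; exists k, m; exact Hm).
    rewrite Cmod_0; lra.
Qed.

(** The reference is the integral at (x, y - d), convergent because d < Re y; the weight t^k (1 -
    t)^d then restores the second exponent and supplies the decay. *)
Lemma ext_Beta_decay (x y : C) (p lambda d : R) :
  ext_Beta_converges p lambda -> 0 < Re x -> 0 < d < Re y ->
  poly_bounded (fun k => ext_Beta (x + INR k) y p lambda) (- d).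
Proof.
  intros Hconv Hx Hd.
  destruct (Hconv x (y - d)%C Hx) as [l Hl]; [destruct y; simpl in *; lra|].
  destruct (abel_beta_weight _ l Hl) as [K [HK H]].
  (* For k >= 1 one has k + 1 <= 2 k, hence (d / k)^d <= (2 d)^d (k + 1)^(-d). Index 0 is excluded
     because the weight bound needs a positive exponent of t. *)
  apply (poly_bounded_eventually _ (- d) (K * Rpower (2 * d) d) 1); intros k Hk.
  apply (le_INR 1) in Hk; simpl INR in Hk.
  destruct (Hconv (x + INR k)%C y) as [m Hm]; [destruct x; simpl in *; lra|lra|].
  unfold ext_Beta; rewrite (CInt01_unique _ _ Hm).
  apply Rle_trans with (K * Rpower (d / INR k) d).
  - apply H; [lra|lra|].
    apply (is_CInt01_ext (ext_beta_integrand (x + INR k) y p lambda)); [|exact Hm].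
    intros t Ht; apply ext_beta_integrand_shift, Ht.
  - rewrite Rmult_assoc; apply Rmult_le_compat_l; [exact HK|].
    rewrite Rpower_Ropp; unfold Rpower at 3; rewrite <- exp_Ropp.
    unfold Rpower; rewrite <- exp_plus; apply exp_le.
    unfold Rdiv; rewrite !ln_mult, ln_Rinv by (try apply Rinv_0_lt_compat; lra).
    assert (ln (INR k + 1) <= ln 2 + ln (INR k))
      by (rewrite <- ln_mult by lra; apply ln_le; lra).
    nra.
Qed.

Definition hl_coef (gamma theta upsilon sigma a : C) (p lambda : R) (k : nat) : C :=
  (pochhammer gamma k * ext_Beta (theta + INR k) (upsilon - theta) p lambda
     / (Beta theta (upsilon - theta) * INR (fact k)) / Cpower (INR k + a) sigma)%C.

Lemma ext_HurwitzLerch_Cpseries (gamma theta upsilon z sigma a : C) (p lambda : R) :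
  ext_HurwitzLerch gamma theta upsilon z sigma a p lambda
  = Cpseries (hl_coef gamma theta upsilon sigma a p lambda) z.
Proof.
  apply CSeries_ext; intros k; unfold hl_coef, Cdiv; ring.
Qed.

(** At 0 this rests on the default value / 0 = 0; the coefficient identity thereby also covers a
    vanishing [Beta]. *)
Lemma Cinv_mult (x y : C) : (/ (x * y))%C = (/ x * / y)%C.
Proof.
  assert (Cinv 0 = RtoC 0) as H0 by (unfold Cinv, RtoC; simpl; f_equal; unfold Rdiv; ring).
  destruct (Ceq_dec x 0) as [->|Hx]; [rewrite Cmult_0_l, H0; ring|].
  destruct (Ceq_dec y 0) as [->|Hy]; [rewrite Cmult_0_r, H0; ring|].
  field; split; assumption.
Qed.

Lemma INR_fact_C_neq_0 (k : nat) : RtoC (INR (fact k)) <> 0.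
Proof. intros E; apply RtoC_inj in E; apply (INR_fact_neq_0 k E). Qed.

Lemma iter_dcoef (n : nat) (c : nat -> C) (k : nat) :
  Nat.iter n dcoef c k = (INR (fact (n + k)) / INR (fact k) * c (n + k)%nat)%C.
Proof.
  revert k; induction n as [|n IH]; intros k; simpl Nat.iter.
  - change (0 + k)%nat with k; field; apply INR_fact_C_neq_0.
  - unfold dcoef; rewrite IH, Nat.add_succ_r.
    change (S n + k)%nat with (S (n + k)).
    rewrite (fact_simpl k), mult_INR, RtoC_mult.
    field; split; [apply INR_fact_C_neq_0|].
    intros E; apply RtoC_inj in E; apply (not_0_INR (S k)); auto.
Qed.

(** Shifting theta and upsilon together leaves upsilon - theta unchanged, so the extended beta
    values on both sides are the same integrals. Only the classical [Beta] in the denominator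
    changes, and its recurrence produces the factor (theta)_n / (upsilon)_n. *)
Lemma hl_coef_iter_dcoef (gamma theta upsilon sigma a : C) (p lambda : R) (n k : nat) :
  0 < Re theta -> 0 < Re (upsilon - theta)%C ->
  Nat.iter n dcoef (hl_coef gamma theta upsilon sigma a p lambda) k
  = (pochhammer gamma n * pochhammer theta n / pochhammer upsilon n
     * hl_coef (gamma + INR n) (theta + INR n) (upsilon + INR n) sigma (a + INR n) p lambda k)%C.
Proof.
  intros Ht Hu; rewrite iter_dcoef; unfold hl_coef.
  replace (upsilon + INR n - (theta + INR n))%C with (upsilon - theta)%C by ring.
  pose proof (Beta_shift theta (upsilon - theta) n Ht Hu) as HB.
  replace (theta + (upsilon - theta))%C with upsilon in HB by ring.
  assert (Hu' : 0 < Re upsilon) by (destruct upsilon, theta; simpl in *; lra).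
  pose proof (pochhammer_neq_0 theta n Ht) as Hpt.
  pose proof (pochhammer_neq_0 upsilon n Hu') as Hpu.
  assert (HB' : (/ Beta theta (upsilon - theta)
    = pochhammer theta n / pochhammer upsilon n * / Beta (theta + INR n) (upsilon - theta))%C).
  { replace (Beta (theta + INR n) (upsilon - theta))%C
      with (pochhammer theta n * / pochhammer upsilon n * Beta theta (upsilon - theta))%C.
    - assert (Hii : (/ / pochhammer upsilon n = pochhammer upsilon n)%C) by (field; exact Hpu).
      rewrite !Cinv_mult, Hii; unfold Cdiv.
      transitivity (pochhammer theta n * / pochhammer theta n
        * (/ pochhammer upsilon n * pochhammer upsilon n) * / Beta theta (upsilon - theta))%C; [|ring].
      rewrite Cinv_r, Cinv_l by assumption; ring.
    - transitivity (pochhammer theta n * Beta theta (upsilon - theta) * / pochhammer upsilon n)%C; [ring|].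
      rewrite <- HB; field; exact Hpu. }
  unfold Cdiv; rewrite !Cinv_mult, HB', pochhammer_add.
  rewrite plus_INR, RtoC_plus.
  replace (theta + (INR n + INR k))%C with (theta + INR n + INR k)%C by ring.
  replace (INR n + INR k + a)%C with (INR k + (a + INR n))%C by ring.
  unfold Cdiv.
  transitivity (pochhammer gamma n * (pochhammer theta n * / pochhammer upsilon n) *
    (pochhammer (gamma + INR n) k * ext_Beta (theta + INR n + INR k) (upsilon - theta) p lambda *
     (/ Beta (theta + INR n) (upsilon - theta) * / INR (fact k)) *
     / Cpower (INR k + (a + INR n)) sigma) * (INR (fact (n + k)) * / INR (fact (n + k))))%C; [ring|].
  rewrite Cinv_r by apply INR_fact_C_neq_0; ring.
Qed.

Lemma hl_coef_poly_bounded (gamma theta upsilon sigma a : C) (p lambda e eps : R) : 0 < eps ->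
  poly_bounded (fun k => ext_Beta (theta + INR k) (upsilon - theta) p lambda) e ->
  poly_bounded (hl_coef gamma theta upsilon sigma a p lambda)
    (Re gamma - 1 + eps + e - Re sigma).
Proof.
  intros Heps He.
  pose proof (poly_bounded_mult _ _ _ _ (poly_bounded_mult _ _ _ _
    (pochhammer_div_fact_poly_bounded gamma eps Heps) He)
    (inv_Cpower_poly_bounded a sigma)) as [M H].
  pose proof (Cmod_ge_0 (/ Beta theta (upsilon - theta))%C).
  exists (Cmod (/ Beta theta (upsilon - theta))%C * M); intros k.
  rewrite Rmult_assoc; eapply Rle_trans; [|apply Rmult_le_compat_l; [assumption|apply H]].
  rewrite <- Cmod_mult; right; f_equal; unfold hl_coef, Cdiv; rewrite Cinv_mult; ring.
Qed.

Lemma hl_derive_n_in (D : C -> Prop) (gamma theta upsilon sigma a : C) (p lambda : R) (n : nat) :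
  0 < Re theta -> 0 < Re (upsilon - theta)%C ->
  (forall z, D z -> exists r, 0 <= r /\ Cmod z <= r /\
     within D (locally (T := C_UniformSpace) z) (fun w => Cmod w <= r) /\
     ex_series (fun k => Cmod (Nat.iter n dcoef (hl_coef gamma theta upsilon sigma a p lambda) k) * r ^ k)) ->
  is_C_derive_n_in D
    (fun z => ext_HurwitzLerch gamma theta upsilon z sigma a p lambda) n
    (fun z => (pochhammer gamma n * pochhammer theta n / pochhammer upsilon n
       * ext_HurwitzLerch (gamma + INR n) (theta + INR n) (upsilon + INR n)
           z sigma (a + INR n) p lambda)%C).
Proof.
  intros Ht Hu HD.
  replace (fun z => ext_HurwitzLerch gamma theta upsilon z sigma a p lambda)
    with (Cpseries (hl_coef gamma theta upsilon sigma a p lambda))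
    by (apply functional_extensionality; intros z; symmetry; apply ext_HurwitzLerch_Cpseries).
  eapply is_C_derive_n_in_ext; [|apply Cpseries_is_derive_n_in, HD].
  intros z Hz; destruct (HD z Hz) as (r & _ & Hzr & _ & Hs).
  pose proof (Cpseries_abs_summable _ r z Hs Hzr) as Habs.
  rewrite ext_HurwitzLerch_Cpseries; unfold Cpseries.
  rewrite <- CSeries_scal.
  - apply CSeries_ext; intros k; rewrite hl_coef_iter_dcoef by assumption; ring.
  - replace (fun k => _) with
      (fun k => (Nat.iter n dcoef (hl_coef gamma theta upsilon sigma a p lambda) k * z ^ k)%C);
      [exact Habs|].
    apply functional_extensionality; intros k; rewrite hl_coef_iter_dcoef by assumption; ring.
Qed.

Theorem theorem3p4
  (p lambda : R) (gamma theta upsilon sigma a : C) (n : nat)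
  (Hp : 0 <= p) (Hlambda : 0 < lambda)
  (Htheta : 0 < Re theta) (Hupsilon : 0 < Re (upsilon - theta)%C)
  (Ha : forall k : nat, a <> (- INR k)%C) :
  is_C_derive_n_in (fun z => Cmod z < 1)
    (fun z => ext_HurwitzLerch gamma theta upsilon z sigma a p lambda) n
    (fun z => (pochhammer gamma n * pochhammer theta n / pochhammer upsilon n
       * ext_HurwitzLerch (gamma + INR n) (theta + INR n) (upsilon + INR n)
           z sigma (a + INR n) p lambda)%C)
  /\
  (ext_Beta_converges p lambda ->
   1 < Re (sigma + (upsilon + INR n) - (gamma + INR n) - (theta + INR n))%C ->
   is_C_derive_n_in (fun z => Cmod z <= 1)
    (fun z => ext_HurwitzLerch gamma theta upsilon z sigma a p lambda) n
    (fun z => (pochhammer gamma n * pochhammer theta n / pochhammer upsilon n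
       * ext_HurwitzLerch (gamma + INR n) (theta + INR n) (upsilon + INR n)
           z sigma (a + INR n) p lambda)%C)).
Proof.
  split.
  - apply hl_derive_n_in; [assumption|assumption|].
    intros z Hz; pose proof (Cmod_ge_0 z).
    exists ((1 + Cmod z) / 2); split; [lra|]; split; [lra|]; split.
    + eapply (filter_imp (F := locally (T := C_UniformSpace) z));
        [|apply (locally_Cmod_lt z ((1 - Cmod z) / 2)); lra].
      intros w Hw _; replace w with (z + (w - z))%C by ring.
      eapply Rle_trans; [apply Cmod_triangle|]; lra.
    + eapply poly_bounded_summable_lt_1; [lra|].
      (* Any exponent will do at a radius below 1; here the beta values count as bounded (exponent
         0) and the slack is 1. *)
      apply poly_bounded_iter_dcoef, (hl_coef_poly_bounded _ _ _ _ _ _ _ 0 1); [lra|].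
      apply ext_Beta_bounded.
  - intros Hconv Hs; apply hl_derive_n_in; [assumption|assumption|].
    intros z Hz; exists 1; split; [lra|]; split; [exact Hz|]; split.
    + apply (filter_forall (F := locally (T := C_UniformSpace) z)); auto.
    + set (b := Re (upsilon - theta)%C) in *.
      set (s := Re sigma + b - Re gamma - INR n).
      assert (Hs' : 1 < s).
      { unfold s, b; destruct sigma, upsilon, gamma, theta; simpl in *; lra. }
      (* The derived coefficients have exponent -1 - s + 2 eps, where one [eps] comes from the
         Pochhammer quotient and one from the decay exponent b - eps. The bound (s - 1) / 2 brings
         this to -2 or below; the bound b / 2 keeps b - eps positive. *)
      set (eps := Rmin (b / 2) ((s - 1) / 2)).
      assert (Heps : 0 < eps) by (apply Rmin_glb_lt; lra).
      assert (Hb : eps <= b / 2) by apply Rmin_l.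
      assert (Hse : eps <= (s - 1) / 2) by apply Rmin_r.
      clearbody eps.
      eapply poly_bounded_summable_1; [|apply poly_bounded_iter_dcoef,
        (hl_coef_poly_bounded _ _ _ _ _ _ _ (- (b - eps)) eps);
        [exact Heps|apply ext_Beta_decay; [assumption|assumption|]]].
      * unfold s in *; lra.
      * fold b; lra.
Qed.
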